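(* Let $R$ be a strong Mori domain. Then the following conditions are equivalent: (1) $R$ is strongly $t$-stable; (2) $R$ is Boole $t$-regular and $t\text{-}\dim(R)=1$.
   Context: All rings are integral domains (commutative with $1$). Let $R$ be a domain with quotient field $F=\mathrm{qf}(R)$. For nonzero $R$-submodules $A,B$ of $F$, $(A:B):=\{x\in F : xB\subseteq A\}$. For a nonzero fractional ideal $I$ of $R$: $I^{-1}:=(R:I)$, $I_v:=(I^{-1})^{-1}$, $I_t:=\bigcup J_v$, where $J$ ranges over the nonzero finitely generated fractional subideals of $I$, and $I_w:=\bigcup (I:J)$, where $J$ ranges over the finitely generated ideals of $R$ with $J^{-1}=R$. $I$ is a $t$-ideal if $I=I_t$ ($t$-ideals are nonzero fractional ideals), and a $w$-ideal if $I=I_w$. $R$ is a strong Mori domain if it satisfies the ascending chain condition on (integral) $w$-ideals, i.e. $w$-ideals contained in $R$. The $t$-class semigroup $\mathcal{S}_t(R)$ is the commutative semigroup of fractional $t$-ideals of $R$ under the $t$-multiplication $(I,J)\mapsto (IJ)_t$, modulo its subsemigroup of nonzero principal fractional ideals; i.e. $t$-ideals $I,J$ have the same class iff $J=cI$ for some $0\neq c\in F$. A semigroup $S$ is Boolean if $x=x^2$ for each $x\in S$. $R$ is Boole $t$-regular if $\mathcal{S}_t(R)$ is a Boolean semigroup. A nonzero ideal $I$ of $R$ is strongly stable if it is principal in its endomorphism ring $(I:I)$, i.e. $I=a(I:I)$ for some $a\in F$. $R$ is strongly $t$-stable if each $t$-ideal of $R$ is strongly stable. A $t$-prime ideal is a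 nonzero prime ideal of $R$ that is a $t$-ideal. The $t$-dimension $t\text{-}\dim(R)$ is the length of the longest chain of $t$-prime ideals of $R$, where $(0)$ is included as the bottom of the chain: a chain $(0)\subsetneq P_1\subsetneq\cdots\subsetneq P_n$ with each $P_i$ a $t$-prime has length $n$.
   Formalization: The formal theorem assumes that R is not a field; for a field, (1) holds but t-dim(R)=0, so (2) fails and the equivalence as stated is false. *)

(* Defs.v *)
From HB Require Import structures.
From mathcomp Require Import all_boot all_algebra.
From mathcomp Require Import monoid generic_quotient ring_quotient fraction.
From mathcomp Require Import boolp classical_sets.

Set Implicit Arguments.
Unset Strict Implicit.
Unset Printing Implicit Defensive.

Import GRing.Theory.
Local Open Scope classical_set_scope.
Local Open Scope ring_scope.
Local Open Scope quotient_scope.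

Section FractionalIdeals.
Variable R : idomainType.
Local Notation F := {fraction R}.
Implicit Types (A B C I J K : set F) (s : seq F).

Local Notation tofrac := (@FracField.tofrac R).
Local Notation "x %:F" := (tofrac x).

Definition base_ring : set F := range tofrac.

Definition submodule A : Prop :=
  [/\ A 0, (forall x y, A x -> A y -> A (x + y))
    & (forall (r : R) x, A x -> A (r%:F * x))].

Definition fractional_ideal I : Prop :=
  [/\ submodule I, (exists2 x, I x & x != 0)
    & (exists2 d : R, d != 0 & forall x, I x -> base_ring (d%:F * x))].

Definition colon A B : set F := [set x | forall y, B y -> A (x * y)].

Definition scale (c : F) A : set F := [set c * x | x in A].

Definition ideal_mul A B : set F :=
  [set x | exists s : seq (F * F),
     (forall p, p \in s -> A p.1 /\ B p.2) /\ x = \sum_(p <- s) p.1 * p.2].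

Definition span s : set F :=
  [set x | exists r : nat -> R, x = \sum_(i < size s) (r i)%:F * s`_i].

Definition finitely_generated A : Prop := exists s, A = span s.

Definition ideal_inv I : set F := colon base_ring I.

Definition v_closure I : set F := ideal_inv (ideal_inv I).

Definition t_closure I : set F :=
  [set x | exists J, [/\ fractional_ideal J, finitely_generated J, J `<=` I
                       & v_closure J x]].

Definition w_closure I : set F :=
  [set x | exists J, [/\ fractional_ideal J, finitely_generated J,
                         J `<=` base_ring, ideal_inv J = base_ring
                       & colon I J x]].

Definition t_ideal I : Prop := fractional_ideal I /\ I = t_closure I.

Definition w_ideal I : Prop := fractional_ideal I /\ I = w_closure I.

Definition t_mul I J : set F := t_closure (ideal_mul I J).

Definition strongly_stable I : Prop := exists a : F, I = scale a (colon I I).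

Definition strong_mori : Prop :=
  forall I : nat -> set F,
    (forall n, w_ideal (I n) /\ I n `<=` base_ring) ->
    (forall n, I n `<=` I n.+1) ->
  exists N, forall n, (N <= n)%N -> I n = I N.

Definition strongly_t_stable : Prop := forall I, t_ideal I -> strongly_stable I.

(* A prime ideal is proper; it is nonzero here because a t-ideal is. *)
Definition t_prime (P : set R) : Prop :=
  [/\ idealr_closed (mem P), prime_idealr_closed (mem P)
    & t_ideal (tofrac @` P)].

Definition t_prime_chain (n : nat) (P : nat -> set R) : Prop :=
  [/\ P 0%N = [set 0], (forall i, (0 < i <= n)%N -> t_prime (P i))
    & (forall i, (i < n)%N -> P i `<` P i.+1)].

(* The sup defining the t-dimension is attained and equals n; since the chains
   start at (0), a field has t-dimension 0. *)
Definition t_dim_eq (n : nat) : Prop :=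
  (exists P, t_prime_chain n P) /\
  (forall m P, t_prime_chain m P -> (m <= n)%N).

Lemma submodule_sum A : submodule A ->
  forall (T : eqType) (l : seq T) (f : T -> F),
  (forall i, i \in l -> A (f i)) -> A (\sum_(i <- l) f i).
Proof.
move=> [A0 AD _] T; elim=> [|x l IH] f H; first by rewrite big_nil.
rewrite big_cons; apply: AD; first by apply: H; rewrite inE eqxx.
by apply: IH => i il; apply: H; rewrite inE il orbT.
Qed.

Lemma span_sub A s : submodule A -> (forall x, x \in s -> A x) -> span s `<=` A.
Proof.
move=> HA Hs _ [r ->]; apply: (submodule_sum HA) => i _.
by case: HA => _ _ AZ; apply/AZ/Hs/mem_nth.
Qed.

Lemma span_submodule s : submodule (span s).
Proof.
split.
- exists (fun=> 0); rewrite big1 // => i _; by rewrite rmorph0 mul0r.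
- move=> _ _ [r ->] [r' ->]; exists (fun i => r i + r' i).
  by rewrite -big_split; apply: eq_bigr => i _; rewrite rmorphD mulrDl.
- move=> a _ [r ->]; exists (fun i => a * r i).
  by rewrite mulr_sumr; apply: eq_bigr => i _; rewrite rmorphM mulrA.
Qed.

Lemma span_mem s x : x \in s -> span s x.
Proof.
move=> xs; have lt_is : (index x s < size s)%N by rewrite index_mem.
exists (fun i => (i == index x s)%:R).
rewrite (bigD1 (Ordinal lt_is)) //= eqxx rmorph1 mul1r nth_index //.
rewrite big1 ?addr0 // => i; rewrite -val_eqE /= => /negPf ->.
by rewrite rmorph0 mul0r.
Qed.

Lemma span_fractional I s : fractional_ideal I -> (forall x, x \in s -> I x) ->
  (exists2 x, x \in s & x != 0) -> fractional_ideal (span s).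
Proof.
move=> [HI _ [d d0 Hd]] Hs [x xs x0]; split; first exact: span_submodule.
  by exists x => //; apply: span_mem.
by exists d => // y /(span_sub HI Hs); apply: Hd.
Qed.

Lemma colon_submodule A B : submodule A -> submodule (colon A B).
Proof.
move=> [A0 AD AZ]; split=> [y _|x y Hx Hy z Bz|r x Hx z Bz].
- by rewrite mul0r.
- by rewrite mulrDl; apply: AD; [apply: Hx|apply: Hy].
- by rewrite -mulrA; apply/AZ/Hx.
Qed.

Lemma base_submodule : submodule base_ring.
Proof.
split; first by exists 0 => //; rewrite rmorph0.
  by move=> _ _ [x _ <-] [y _ <-]; exists (x + y) => //; rewrite rmorphD.
by move=> r _ [x _ <-]; exists (r * x) => //; rewrite rmorphM.
Qed.

Lemma v_submodule A : submodule (v_closure A).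
Proof. exact/colon_submodule/base_submodule. Qed.

Lemma sub_v A : A `<=` v_closure A.
Proof. by move=> x Ax y Hy; rewrite mulrC; apply: Hy. Qed.

Lemma inv_anti A B : A `<=` B -> ideal_inv B `<=` ideal_inv A.
Proof. by move=> AB x Hx y /AB; apply: Hx. Qed.

Lemma v_min A B : A `<=` v_closure B -> v_closure A `<=` v_closure B.
Proof.
move=> AB; apply: inv_anti => x Hx y Ay; rewrite mulrC.
by move/AB: Ay; apply.
Qed.

Lemma v_mono A B : A `<=` B -> v_closure A `<=` v_closure B.
Proof. by move=> AB; apply: v_min => x /AB; apply: sub_v. Qed.

Lemma t_mono A B : A `<=` B -> t_closure A `<=` t_closure B.
Proof.
by move=> AB x [J [J1 J2 J3 J4]]; exists J; split=> // y /J3 /AB.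
Qed.

Lemma t_witness I s : fractional_ideal I -> (forall x, x \in s -> t_closure I x) ->
  exists s', [/\ (forall x, x \in s' -> I x), (exists2 x, x \in s' & x != 0)
    & (forall x, x \in s -> v_closure (span s') x)].
Proof.
move=> HI; elim: s => [_|x s IH Hs].
  case: HI => _ [y Iy y0] _; exists [:: y]; split=> //.
    by move=> z; rewrite inE => /eqP ->.
  by exists y; rewrite ?inE.
have [|s1 [H1 [y ys y0] H3]] := IH.
  by move=> z zs; apply: Hs; rewrite inE zs orbT.
have [J [_ [s2 ->] J3 J4]] : t_closure I x by apply: Hs; rewrite inE eqxx.
exists (s1 ++ s2); split.
- move=> z; rewrite mem_cat => /orP[/H1 //|zs2].
  exact/J3/span_mem.
- by exists y => //; rewrite mem_cat ys.
- move=> z; rewrite inE => /orP[/eqP ->|/H3].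
    apply: v_mono J4; apply: span_sub; first exact: span_submodule.
    by move=> u us; apply: span_mem; rewrite mem_cat us orbT.
  apply: v_mono; apply: span_sub; first exact: span_submodule.
  by move=> u us; apply: span_mem; rewrite mem_cat us.
Qed.

Lemma t_intro I s x : fractional_ideal I -> (forall x, x \in s -> I x) ->
  (exists2 x, x \in s & x != 0) -> v_closure (span s) x -> t_closure I x.
Proof.
move=> HI H1 H2 H3; exists (span s); split=> //.
- exact: span_fractional HI H1 H2.
- by exists s.
- by apply: span_sub => //; case: HI.
Qed.

Lemma sub_t I : fractional_ideal I -> I `<=` t_closure I.
Proof.
move=> HI x Ix; have [_ [y Iy y0] _] := HI.
apply: (@t_intro I [:: x; y]) => //.
- by move=> z; rewrite !inE => /orP[] /eqP ->.
- by exists y; rewrite ?inE ?eqxx ?orbT.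
- by apply/sub_v/span_mem; rewrite inE eqxx.
Qed.

Lemma t_fractional I : fractional_ideal I -> fractional_ideal (t_closure I).
Proof.
move=> HI; have [[I0 _ _] [y Iy y0] [d d0 Hd]] := HI; split.
- split; first exact: sub_t.
    move=> a b Ha Hb.
    have [|s' [s1 s2 s3]] := @t_witness I [:: a; b] HI.
      by move=> z; rewrite !inE => /orP[] /eqP ->.
    apply: (t_intro HI s1 s2); have [_ VD _] := v_submodule (span s').
    by apply: VD; apply: s3; rewrite !inE eqxx ?orbT.
  move=> r a Ha.
  have [|s' [s1 s2 s3]] := @t_witness I [:: a] HI.
    by move=> z; rewrite !inE => /eqP ->.
  apply: (t_intro HI s1 s2); have [_ _ VZ] := v_submodule (span s').
  by apply: VZ; apply: s3; rewrite inE.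
- by exists y => //; apply: sub_t.
- exists d => // x [J [_ _ JI Jx]]; rewrite mulrC; apply: Jx => z /JI.
  exact: Hd.
Qed.

Lemma t_min I A : fractional_ideal I -> A `<=` t_closure I ->
  t_closure A `<=` t_closure I.
Proof.
move=> HI AI x [J [_ [s ->] JA Jx]].
have [|s' [s1 s2 s3]] := @t_witness I s HI.
  by move=> z zs; apply/AI/JA/span_mem.
apply: (t_intro HI s1 s2); apply: v_min Jx.
apply: span_sub s3; exact: v_submodule.
Qed.

Lemma t_ideal_t I : fractional_ideal I -> t_ideal (t_closure I).
Proof.
move=> HI; split; first exact: t_fractional.
apply/seteqP; split; first exact/sub_t/t_fractional.
exact: t_min.
Qed.

Lemma ideal_mul_in A B x y : A x -> B y -> ideal_mul A B (x * y).
Proof.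
move=> Ax By; exists [:: (x, y)]; rewrite big_seq1; split=> // p.
by rewrite inE => /eqP ->.
Qed.

Lemma ideal_mul_sub A B C : submodule C -> (forall x y, A x -> B y -> C (x * y)) ->
  ideal_mul A B `<=` C.
Proof.
move=> HC H _ [s [Hs ->]]; apply: (submodule_sum HC) => p /Hs [? ?].
exact: H.
Qed.

Lemma ideal_mul_submodule A B : submodule A -> submodule (ideal_mul A B).
Proof.
move=> [_ _ AZ]; split.
- by exists [::]; rewrite big_nil.
- move=> _ _ [s [Hs ->]] [s' [Hs' ->]]; exists (s ++ s').
  rewrite big_cat; split=> // p.
  by rewrite mem_cat => /orP[/Hs|/Hs'].
- move=> r _ [s [Hs ->]]; exists [seq (r%:F * p.1, p.2) | p <- s].
  rewrite big_map mulr_sumr; split.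
    by move=> _ /mapP[p /Hs [? ?] ->] /=; split=> //; apply: AZ.
  by apply: eq_bigr => p _; rewrite mulrA.
Qed.

Lemma ideal_mulC A B : ideal_mul A B = ideal_mul B A.
Proof.
suff H X Y : ideal_mul X Y `<=` ideal_mul Y X by apply/seteqP; split.
move=> _ [s [Hs ->]]; exists [seq (p.2, p.1) | p <- s]; rewrite big_map; split.
  by move=> _ /mapP[p /Hs [? ?] ->].
by apply: eq_bigr => p _; rewrite mulrC.
Qed.

Lemma ideal_mul_fractional I J : fractional_ideal I -> fractional_ideal J ->
  fractional_ideal (ideal_mul I J).
Proof.
move=> [HI [x Ix x0] [d d0 Hd]] [HJ [y Jy y0] [e e0 He]]; split.
- exact: ideal_mul_submodule.
- by exists (x * y); [apply: ideal_mul_in|rewrite mulf_neq0].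
- exists (d * e); first by rewrite mulf_neq0.
  suff: ideal_mul I J `<=` [set z | base_ring ((d * e)%:F * z)] by [].
  apply: ideal_mul_sub.
    have [B0 BD BZ] := base_submodule; split=> /=.
    + by rewrite mulr0.
    + by move=> u v; rewrite mulrDr; apply: BD.
    + by move=> r u Hu; rewrite mulrCA; apply: BZ.
  move=> u v /Hd [a _ Ha] /He [b _ Hb] /=.
  by exists (a * b) => //; rewrite !rmorphM /= Ha Hb mulrACA.
Qed.

Lemma ideal_mulA A B C : submodule A -> submodule B -> submodule C ->
  ideal_mul A (ideal_mul B C) = ideal_mul (ideal_mul A B) C.
Proof.
have H X Y Z : submodule X -> submodule Y -> submodule Z ->
    ideal_mul X (ideal_mul Y Z) `<=` ideal_mul (ideal_mul X Y) Z.
  move=> HX HY HZ; apply: ideal_mul_sub; first exact/ideal_mul_submodule/ideal_mul_submodule.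
  move=> x w Xx [s [Hs ->]]; rewrite mulr_sumr.
  apply: submodule_sum; first exact/ideal_mul_submodule/ideal_mul_submodule.
  move=> p /Hs [? ?]; rewrite mulrA; apply: ideal_mul_in => //; exact: ideal_mul_in.
move=> HA HB HC; apply/seteqP; split; first exact: H.
by rewrite ideal_mulC (ideal_mulC A) (ideal_mulC A (ideal_mul B C)) (ideal_mulC B C); apply: H.
Qed.

Lemma scaleA (c d : F) A : scale c (scale d A) = scale (c * d) A.
Proof.
by rewrite /scale image_comp; apply: eq_imagel => x _ /=; rewrite mulrA.
Qed.

Lemma scale1 A : scale 1 A = A.
Proof.
apply/seteqP; split=> x; first by case=> y Ay <-; rewrite mul1r.
by exists x => //; rewrite mul1r.
Qed.

Lemma scale_submodule c A : submodule A -> submodule (scale c A).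
Proof.
move=> [A0 AD AZ]; split.
- by exists 0 => //; rewrite mulr0.
- move=> _ _ [x Ax <-] [y Ay <-]; exists (x + y); first exact: AD.
  by rewrite mulrDr.
- move=> r _ [x Ax <-]; exists (r%:F * x); first exact: AZ.
  by rewrite mulrCA.
Qed.

Lemma scale_v c A x : v_closure A x -> v_closure (scale c A) (c * x).
Proof.
move=> Hx y Hy; rewrite mulrAC mulrC; apply: Hx => z Az.
by rewrite [c * y]mulrC -mulrA; apply: Hy; exists z.
Qed.

Lemma t_in I s c x : fractional_ideal I -> (forall y, y \in s -> I (c * y)) ->
  (exists2 y, y \in s & y != 0) -> v_closure (span s) x -> t_closure I (c * x).
Proof.
move=> HI Hs [y ys y0] Hx; have [-> | c0] := eqVneq c 0.
  by rewrite mul0r; have [[]] := t_fractional HI.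
apply: (@t_intro I [seq c * z | z <- s]) => //.
- by move=> _ /mapP[z zs ->]; apply: Hs.
- by exists (c * y); [apply: map_f|rewrite mulf_neq0].
- have := scale_v (c := c) Hx; apply: v_mono.
  move=> _ [z + <-].
  suff: span s `<=` [set z | span [seq c * z | z <- s] (c * z)] by apply.
  have [B0 BD BZ] := span_submodule [seq c * z | z <- s].
  apply: span_sub; last by move=> u us; apply/span_mem/map_f.
  split=> /=; first by rewrite mulr0.
    by move=> u w; rewrite mulrDr; apply: BD.
  by move=> r u Hu; rewrite mulrCA; apply: BZ.
Qed.

Lemma t_gen I x : fractional_ideal I -> t_closure I x ->
  exists s, [/\ (forall y, y \in s -> I y), (exists2 y, y \in s & y != 0)
    & v_closure (span s) x].
Proof.
move=> HI Hx; have [|s [s1 s2 s3]] := @t_witness I [:: x] HI.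
  by move=> z; rewrite inE => /eqP ->.
by exists s; split=> //; apply: s3; rewrite inE.
Qed.

Lemma t_mulml I J : fractional_ideal I -> fractional_ideal J ->
  t_mul (t_closure I) J = t_mul I J.
Proof.
move=> HI HJ; have HIJ := ideal_mul_fractional HI HJ.
have HT := t_fractional HIJ; have [ST _ _] := HT.
apply/seteqP; split; last first.
  apply: t_mono; apply: ideal_mul_sub.
    by apply: ideal_mul_submodule; case: (t_fractional HI).
  by move=> x y Ix Jy; apply: ideal_mul_in => //; apply: sub_t.
apply: t_min => //; apply: ideal_mul_sub => // x y Ix Jy.
have [s [s1 s2 s3]] := t_gen HI Ix.
rewrite mulrC; apply: t_in HIJ _ s2 s3 => z /s1 Iz.
by rewrite mulrC; apply: ideal_mul_in.
Qed.

Lemma t_mulC I J : t_mul I J = t_mul J I.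
Proof. by rewrite /t_mul ideal_mulC. Qed.

Lemma t_mulA I J K : fractional_ideal I -> fractional_ideal J ->
  fractional_ideal K -> t_mul I (t_mul J K) = t_mul (t_mul I J) K.
Proof.
move=> HI HJ HK; rewrite t_mulC !t_mulml //; try exact: ideal_mul_fractional.
case: HI HJ HK => [SI _ _] [SJ _ _] [SK _ _].
by rewrite /t_mul ideal_mulC ideal_mulA.
Qed.

Lemma ideal_mul_scale c d I J : submodule I ->
  ideal_mul (scale c I) (scale d J) = scale (c * d) (ideal_mul I J).
Proof.
move=> SI; apply/seteqP; split.
  apply: ideal_mul_sub; first exact/scale_submodule/ideal_mul_submodule.
  move=> _ _ [x Ix <-] [y Jy <-]; exists (x * y); last by rewrite mulrACA.
  exact: ideal_mul_in.
move=> _ [_ [s [Hs ->]] <-]; exists [seq (c * p.1, d * p.2) | p <- s].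
rewrite big_map mulr_sumr; split; last first.
  by apply: eq_bigr => p _; rewrite mulrACA.
by move=> _ /mapP[p /Hs [? ?] ->]; split; [exists p.1|exists p.2].
Qed.

Lemma frac_base (c : F) : exists2 e : R, e != 0 & base_ring (e%:F * c).
Proof.
elim/quotW: c => x; exists (frac x).2; first exact: denom_ratioP.
exists (frac x).1 => //; rewrite /FracField.tofrac; unlock.
rewrite -[RHS]FracField.pi_mul; apply/eqmodP.
rewrite /= FracField.equivfE /FracField.mulf.
have x0 := denom_ratioP x.
by rewrite !numden_Ratio ?oner_neq0 ?mul1r // mulrC.
Qed.

Lemma scale_fractional c I : c != 0 -> fractional_ideal I ->
  fractional_ideal (scale c I).
Proof.
move=> c0 [SI [x Ix x0] [d d0 Hd]]; split; first exact: scale_submodule.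
  by exists (c * x); [exists x|rewrite mulf_neq0].
have [e e0 [n _ En]] := frac_base c.
exists (e * d); first by rewrite mulf_neq0.
move=> _ [y /Hd Hy <-]; rewrite rmorphM mulrACA -En.
by case: base_submodule => _ _; apply.
Qed.

Lemma t_scale c I : c != 0 -> fractional_ideal I ->
  t_closure (scale c I) = scale c (t_closure I).
Proof.
have H a A : a != 0 -> fractional_ideal A ->
    scale a (t_closure A) `<=` t_closure (scale a A).
  move=> a0 HA _ [x Ax <-]; have [s [s1 s2 s3]] := t_gen HA Ax.
  apply: t_in s2 s3; first exact: scale_fractional.
  by move=> y /s1 Ay; exists y.
move=> c0 HI; apply/seteqP; split; last exact: H.
move=> x Hx; exists (c^-1 * x); last by rewrite mulVKf.
rewrite -[I]scale1 -(mulVf c0) -scaleA; apply: H.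
- by rewrite invr_eq0.
- exact: scale_fractional.
- by exists x.
Qed.

Lemma t_mul_scale c d I J : c != 0 -> d != 0 -> fractional_ideal I ->
  fractional_ideal J -> t_mul (scale c I) (scale d J) = scale (c * d) (t_mul I J).
Proof.
move=> c0 d0 HI HJ; rewrite /t_mul ideal_mul_scale; last by case: HI.
by rewrite t_scale ?mulf_neq0 //; apply: ideal_mul_fractional.
Qed.

Definition tideal : Type := {I : set F | `[< t_ideal I >]}.
HB.instance Definition _ := SubChoice.on tideal.

Lemma tideal_frac (I : tideal) : fractional_ideal (val I).
Proof. by have /asboolP[] := valP I. Qed.

Lemma t_mul_subproof (I J : tideal) : `[< t_ideal (t_mul (val I) (val J)) >].
Proof.
apply/asboolP/t_ideal_t/ideal_mul_fractional; exact: tideal_frac.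
Qed.

Definition tideal_mul (I J : tideal) : tideal :=
  exist _ (t_mul (val I) (val J)) (t_mul_subproof I J).

Definition same_t_class (I J : tideal) : bool :=
  `[< exists2 c : F, c != 0 & val J = scale c (val I) >].

Lemma same_t_class_refl : reflexive same_t_class.
Proof.
by move=> I; apply/asboolP; exists 1; rewrite ?oner_neq0 ?scale1.
Qed.

Lemma same_t_class_sym : symmetric same_t_class.
Proof.
suff H (I J : tideal) : same_t_class I J -> same_t_class J I.
  by move=> I J; apply/idP/idP; apply: H.
move=> /asboolP[c c0 HJ]; apply/asboolP; exists c^-1; first by rewrite invr_eq0.
by rewrite HJ scaleA mulVf ?scale1.
Qed.

Lemma same_t_class_trans : transitive same_t_class.
Proof.
move=> J I K /asboolP[c c0 HJ] /asboolP[d d0 HK]; apply/asboolP.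
by exists (d * c); rewrite ?mulf_neq0 // HK HJ scaleA.
Qed.

Canonical same_t_class_equiv :=
  EquivRel same_t_class same_t_class_refl same_t_class_sym same_t_class_trans.

Definition t_class_semigroup : Type := {eq_quot same_t_class}.
HB.instance Definition _ := Choice.on t_class_semigroup.
HB.instance Definition _ := EqQuotient.on t_class_semigroup.

Definition t_class_mul (x y : t_class_semigroup) : t_class_semigroup :=
  \pi_t_class_semigroup (tideal_mul (repr x) (repr y)).

Lemma pi_t_class_mul (I J : tideal) :
  t_class_mul (\pi I) (\pi J) = \pi_t_class_semigroup (tideal_mul I J).
Proof.
have E (K : tideal) :
    exists2 c : F, c != 0 & val (repr (\pi_t_class_semigroup K)) = scale c (val K).
  by apply/asboolP; rewrite -/(same_t_class _ _); apply/eqmodP; rewrite reprK.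
have [c c0 HI] := E I; have [d d0 HJ] := E J.
apply/esym/eqmodP/asboolP; exists (c * d); first by rewrite mulf_neq0.
by rewrite /= HI HJ t_mul_scale //; apply: tideal_frac.
Qed.

Lemma t_class_mulA : associative t_class_mul.
Proof.
elim/quotW=> I; elim/quotW=> J; elim/quotW=> K; rewrite !pi_t_class_mul.
by congr \pi; apply/val_inj/t_mulA; apply: tideal_frac.
Qed.

Lemma t_class_mulC : commutative t_class_mul.
Proof.
elim/quotW=> I; elim/quotW=> J; rewrite !pi_t_class_mul.
by congr \pi; apply/val_inj/t_mulC.
Qed.

HB.instance Definition _ := isSemigroup.Build t_class_semigroup t_class_mulA.

End FractionalIdeals.

Definition boolean_semigroup (S : semigroupType) : Prop :=
  forall x : S, x = (x * x)%g.

Definition boole_t_regular (R : idomainType) : Prop :=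
  boolean_semigroup (t_class_semigroup R).

(* Main.v *)
Require Import Defs.
From mathcomp Require Import all_boot all_algebra.
From mathcomp Require Import fraction generic_quotient ring boolp classical_sets.

(** (1) => (2): if [I = a(I : I)] then [I^2 = a I], so the class of [I] is
    idempotent. For a t-prime [Q = a(Q : Q)] this gives [Q^2 = a Q]; in the
    Noetherian local ring [R_Q] the maximal ideal [m] then satisfies
    [m^2 = a m], and the proof of Krull's principal ideal theorem shows that
    every nonzero [b] in [R_Q] divides a power of [a]. Hence a nonzero prime
    inside [Q] contains [a], so [Q^2], so [Q].

    (2) => (1): after scaling, [(I^2)_t = I], and it suffices that [1] is in [I].
    Otherwise [I `&` R] lies in a t-prime [Q]. Put [D = I^-1]; then
    [(D : I) = (I^2)^-1 = D]. As t-dim 1 makes [R_Q] one-dimensional, [E = D_Q]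
    has finite length modulo [x E], for any nonzero [x] in [I]; no nonzero
    element of [E / x E] is killed by [I], so [u E] is contained in [x E] for
    some [u] congruent to [1] modulo [I_Q = (R_Q : E)]. Then [u / x] is in
    [(E : E)], so [u] and [1] lie in [I_Q], a contradiction. *)

Import GRing.Theory.
Local Open Scope ring_scope.

(** * Local subrings of a field and chain conditions on their modules *)

Section LocalSubrings.
Local Set Implicit Arguments.
Local Unset Strict Implicit.
Local Open Scope classical_set_scope.
Variables (K : fieldType) (A m : set K).
Implicit Types (N M W X : set K) (a b c x y z : K).

Definition amodule N : Prop :=
  [/\ N 0, (forall x y, N x -> N y -> N (x + y))
    & (forall a x, A a -> N x -> N (a * x))].

(** Closure of [A] under products is part of [amodule A]; the last clause makes [m] the unique
    maximal ideal. *)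
Definition local_subring : Prop :=
  [/\ amodule A, A 1, A (-1), amodule m & [/\ m `<=` A, ~ m 1
    & forall x, A x -> ~ m x -> A x^-1]].

(* Only nonzero submodules, because [strong_mori] is about nonzero ideals. *)
Definition noetherian_subring : Prop := forall Fam : set (set K),
  (forall N, Fam N -> [/\ amodule N, N `<=` A & exists2 x, N x & x != 0]) ->
  (exists N, Fam N) ->
  exists2 M, Fam M & forall N, Fam N -> M `<=` N -> N `<=` M.

(** For [N] inside [M] this says that [M / N] is Artinian, as a minimum condition that avoids
    forming the quotient. *)
Definition dcc N M : Prop := forall Fam : set (set K),
  (forall W, Fam W -> [/\ amodule W, N `<=` W & W `<=` M]) ->
  (exists W, Fam W) ->
  exists2 W, Fam W & forall W', Fam W' -> W' `<=` W -> W `<=` W'.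

Definition addmod N M : set K := [set x | exists y z, [/\ N y, M z & x = y + z]].

Definition cyclic x : set K := [set a * x | a in A].

Hypothesis Aloc : local_subring.

Lemma amodule_opp N x : amodule N -> N x -> N (- x).
Proof. by case: Aloc => _ _ A_1 _ _ [_ _ NZ] Nx; rewrite -mulN1r; apply: NZ. Qed.

Lemma amodule_sub N x y : amodule N -> N x -> N y -> N (x - y).
Proof. by move=> HN Nx Ny; have [_ ND _] := HN; apply: ND => //; apply: amodule_opp. Qed.

Lemma addmod_amodule N M : amodule N -> amodule M -> amodule (addmod N M).
Proof.
move=> [N0 ND NZ] [M0 MD MZ]; split.
- by exists 0, 0; rewrite addr0.
- move=> _ _ [y [z [Ny Mz ->]]] [y' [z' [Ny' Mz' ->]]].
  by exists (y + y'), (z + z'); split; [apply: ND|apply: MD|rewrite addrACA].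
- move=> a _ Aa [y [z [Ny Mz ->]]]; exists (a * y), (a * z).
  by split; [apply: NZ|apply: MZ|rewrite mulrDr].
Qed.

Lemma addmodl N M : amodule M -> N `<=` addmod N M.
Proof. by move=> [M0 _ _] x Nx; exists x, 0; rewrite addr0. Qed.

Lemma addmodr N M : amodule N -> M `<=` addmod N M.
Proof. by move=> [N0 _ _] x Mx; exists 0, x; rewrite add0r. Qed.

Lemma addmod_min N M W : amodule W -> N `<=` W -> M `<=` W -> addmod N M `<=` W.
Proof. by move=> [_ WD _] NW MW _ [y [z [/NW Wy /MW Wz ->]]]; apply: WD. Qed.

Lemma addmodS N M N' M' : N `<=` N' -> M `<=` M' -> addmod N M `<=` addmod N' M'.
Proof. by move=> NN MM _ [y [z [/NN Ny /MM Mz ->]]]; exists y, z. Qed.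

Lemma cyclic_amodule x : amodule (cyclic x).
Proof.
have [[A0 AD AZ] _ _ _ _] := Aloc; split.
- by exists 0; rewrite ?mul0r.
- by move=> _ _ [a Aa <-] [b Ab <-]; exists (a + b); [apply: AD|rewrite mulrDl].
- by move=> a _ Aa [b Ab <-]; exists (a * b); [apply: AZ|rewrite mulrA].
Qed.

Lemma cyclic_id x : cyclic x x.
Proof. by have [_ A1 _ _ _] := Aloc; exists 1; rewrite ?mul1r. Qed.

Lemma cyclic_min N x : amodule N -> N x -> cyclic x `<=` N.
Proof. by move=> [_ _ NZ] Nx _ [a Aa <-]; apply: NZ. Qed.

Lemma image_amodule N c : amodule N -> amodule [set c * x | x in N].
Proof.
move=> [N0 ND NZ]; split.
- by exists 0; rewrite ?mulr0.
- by move=> _ _ [x Nx <-] [y Ny <-]; exists (x + y); [apply: ND|rewrite mulrDr].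
- by move=> a _ Aa [x Nx <-]; exists (a * x); [apply: NZ|rewrite mulrCA].
Qed.

Lemma preimage_amodule N c : amodule N -> amodule [set x | N (c * x)].
Proof.
move=> [N0 ND NZ]; split=> [|x y Nx Ny|a x Aa Nx] /=.
- by rewrite mulr0.
- by rewrite mulrDr; apply: ND.
- by rewrite mulrCA; apply: NZ.
Qed.

Lemma setI_amodule N M : amodule N -> amodule M -> amodule (N `&` M).
Proof.
move=> [N0 ND NZ] [M0 MD MZ]; split=> //.
- by move=> x y [? ?] [? ?]; split; [apply: ND|apply: MD].
- by move=> a x ? [? ?]; split; [apply: NZ|apply: MZ].
Qed.

Lemma amodule_eqA N x : amodule N -> A x -> ~ m x -> N x -> A `<=` N.
Proof.
move=> [_ _ NZ] Ax mx Nx y Ay; have [[_ _ AZ] _ _ [m0 _ _] [_ _ Ainv]] := Aloc.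
have x0 : x != 0 by apply/eqP => x0; apply: mx; rewrite x0.
by rewrite -[y](mulfVK x0) ; apply: NZ => //; apply: AZ => //; apply: Ainv.
Qed.

Lemma sub1_inv a x : m a -> A x -> A (1 - a * x)^-1 /\ 1 - a * x != 0.
Proof.
move=> ma Ax; have [AA A1 _ mm [mA m1 Ainv]] := Aloc; have [m0 mD mZ] := mm.
have max : m (a * x) by rewrite mulrC; apply: mZ.
have nm : ~ m (1 - a * x) by move=> H; apply: m1; rewrite -(subrK (a * x) 1); apply: mD.
split; last by apply/eqP => e; apply: nm; rewrite e.
by apply: Ainv nm; apply: amodule_sub => //; apply: mA.
Qed.

Lemma dcc_sub N M N' M' : dcc N M -> N `<=` N' -> M' `<=` M -> dcc N' M'.
Proof.
move=> H NN MM Fam HF; apply: H => W /HF[? ? ?]; split=> //.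
  exact: subset_trans NN _.
exact: subset_trans MM.
Qed.

Lemma dcc_refl N : dcc N N.
Proof.
move=> Fam HF [W FW]; exists W => // W' /HF[_ NW' _] _.
by have [_ _ WN] := HF _ FW; apply: subset_trans NW'.
Qed.

(** First [W + M] is minimized, then the intersection of [W] with [M] among the members with that
    sum; by the modular law such a [W] is minimal. *)
Lemma dcc_trans M N X : amodule M -> amodule X -> N `<=` M -> M `<=` X ->
  dcc N M -> dcc M X -> dcc N X.
Proof.
move=> HM HX NM MX H1 H2 Fam HF [W0 FW0].
have [_ [W1 FW1 <-] min1] : exists2 V, [set addmod W M | W in Fam] V &
    forall V', [set addmod W M | W in Fam] V' -> V' `<=` V -> V `<=` V'.
  apply: H2; last by exists (addmod W0 M), W0.
  move=> _ [W /HF[HW NW WX] <-]; split; first exact: addmod_amodule.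
    exact: addmodr.
  exact: addmod_min.
pose Fam1 := [set W | Fam W /\ addmod W M `<=` addmod W1 M].
have [_ [W [FW WW1] <-] min2] : exists2 V, [set W `&` M | W in Fam1] V &
    forall V', [set W `&` M | W in Fam1] V' -> V' `<=` V -> V `<=` V'.
  apply: H1; last by exists (W1 `&` M), W1 => //; split.
  move=> _ [W [/HF[HW NW WX] _] <-]; split; first exact: setI_amodule.
    by move=> x Nx; split; [apply: NW|apply: NM].
  by move=> x [].
exists W => // W' FW' W'W x Wx; have [HW _ _] := HF _ FW.
have [HW' _ _] := HF _ FW'.
have WM' : addmod W' M `<=` addmod W1 M.
  by apply: subset_trans WW1; apply: addmodS.
have [y [z [W'y Mz xE]]] : addmod W' M x.
  by apply: min1 => //; [exists W'|apply/WW1/addmodl].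
have : (W `&` M) z.
  split=> //; rewrite (_ : z = x - y); last by rewrite xE addrAC subrr add0r.
  by apply: amodule_sub => //; apply: W'W.
move/(min2 (W' `&` M)) => [].
- by exists W'.
- by move=> t [/W'W ? ?].
- by move=> W'z _; rewrite xE; case: HW' => _ WD _; apply: WD.
Qed.

(** The quotient is killed by [m], hence zero or simple: a member of the family without [x] lies in
    [N], and one with [x] is everything. *)
Lemma dcc_simple N x : amodule N -> (forall a, m a -> N (a * x)) ->
  dcc N (addmod N (cyclic x)).
Proof.
move=> HN mx Fam HF [W0 FW0]; have Cx := cyclic_amodule x.
have [[W FW Wx]|all_x] := pselect (exists2 W, Fam W & ~ W x).
  exists W => // W' /HF[_ NW' _] _ _w; have [HW NW WN] := HF _ FW.
  move=> Ww; have [n [_ [Nn [a Aa <-] wE]]] := WN _ Ww.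
  have Wax : W (a * x).
    rewrite (_ : a * x = _w - n); last by rewrite wE addrAC subrr add0r.
    by apply: amodule_sub => //; apply: NW.
  have ma : m a.
    apply: contrapT => ma; apply: Wx.
    have [[_ _ _] _ _ [m0 _ _] [_ _ Ainv]] := Aloc.
    have a0 : a != 0 by apply/eqP => a0; apply: ma; rewrite a0.
    by rewrite -(mulKf a0 x); case: HW => _ _; apply=> //; apply: Ainv.
  by rewrite wE; case: HN => _ ND _; apply: NW'; apply: ND => //; apply: mx.
exists W0 => // W' FW' _; have [HW' NW' _] := HF _ FW'; have [_ _] := HF _ FW0.
move=> /subset_trans; apply; apply: addmod_min => //; apply: cyclic_min => //.
by apply: contrapT => W'x; apply: all_x; exists W'.
Qed.

Lemma dcc_scale c N M : c != 0 ->
  dcc [set c * x | x in N] [set c * x | x in M] -> dcc N M.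
Proof.
move=> c0 H Fam HF [W0 FW0].
have inj W W' : [set c * x | x in W] `<=` [set c * x | x in W'] -> W `<=` W'.
  move=> WW x Wx; have [|y W'y /(mulfI c0) <- //] := WW (c * x).
  by exists x.
have [_ [W FW <-] minW] : exists2 V, [set [set c * x | x in W] | W in Fam] V &
    forall V', [set [set c * x | x in W] | W in Fam] V' -> V' `<=` V -> V `<=` V'.
  apply: H; last by exists [set c * x | x in W0], W0.
  move=> _ [W /HF[HW NW WM] <-]; split; first exact: image_amodule.
    exact: image_subset.
  exact: image_subset.
exists W => // W' FW' WW; apply: inj; apply: minW; first by exists W'.
exact: image_subset.
Qed.

(** * Noetherian local subrings: Nakayama, Krull and Artinian quotients *)

Hypothesis Anoeth : noetherian_subring.

(* Noetherian induction replaces finite generation in Nakayama's lemma. *)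
Lemma nakayama N M a : amodule N -> amodule M -> M `<=` A -> N `<=` M ->
  (exists2 x, N x & x != 0) -> m a ->
  (forall x, M x -> exists y z, [/\ N y, M z & x = y + a * z]) -> M `<=` N.
Proof.
move=> HN HM MA NM [n0 Nn0 n00] ma MN; apply: contrapT => nMN.
have [||N' [HN' NN' N'M nMN'] maxN'] := Anoeth
    (Fam := [set N' | [/\ amodule N', N `<=` N', N' `<=` M & ~ M `<=` N']]).
- move=> N' [HN' NN' N'M _]; split=> //; first exact: subset_trans MA.
  by exists n0 => //; apply: NN'.
- by exists N; split.
have [x Mx N'x] : exists2 x, M x & ~ N' x.
  by apply: contrapT => H; apply: nMN' => x Mx; apply: contrapT => ?; apply: H; exists x.
have Cx := cyclic_amodule x.
have MNx : M `<=` addmod N' (cyclic x).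
  apply: contrapT => H; apply: N'x; apply: (maxN' (addmod N' (cyclic x))).
  - split=> //; first exact: addmod_amodule.
    + by apply: subset_trans NN' _; apply: addmodl.
    + by apply: addmod_min => //; apply: cyclic_min.
  - exact: addmodl.
  - by apply: addmodr => //; apply: cyclic_id.
(* Writing [x = y + a (n' + b x)] puts [(1 - a b) x] in [N'], and [1 - a b] is a unit. *)
have [y [_ [Ny /MNx[n' [_ [N'n' [b Ab <-] ->]]] xE]]] := MN _ Mx.
have [Ainv u0] := sub1_inv ma Ab; apply: N'x.
have [_ _ N'Z] := HN'; have [_ N'D _] := HN'.
have [_ _ _ _ [mA _ _]] := Aloc.
rewrite -(mulKf u0 x); apply: (N'Z) => //.
rewrite (_ : (1 - a * b) * x = y + a * n').
  by apply: N'D; [apply: NN'|apply: N'Z => //; apply: mA].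
by rewrite mulrBl mul1r {1}xE; ring.
Qed.

(** Since [m ^ 2] lies in [a m], [m] kills [m / a m]. Adjoining one element to [N] adds at most a
    simple module, so a maximal [N] with [N / a m] Artinian is all of [m]. *)
Lemma dcc_principal_reduction a : a != 0 -> m a ->
  (forall x y, m x -> m y -> exists2 z, m z & x * y = a * z) ->
  dcc [set a * x | x in m] m.
Proof.
move=> a0 ma mm; have [_ _ _ Hm [mA _ _]] := Aloc.
have Ham := image_amodule a Hm.
have amm : [set a * x | x in m] `<=` m.
  by move=> _ [x mx <-]; case: Hm => _ _; apply=> //; apply: mA.
have [||N [HN aN Nm dN] maxN] := Anoeth (Fam :=
  [set N | [/\ amodule N, [set a * x | x in m] `<=` N, N `<=` m
             & dcc [set a * x | x in m] N]]).
- move=> N [HN aN Nm _]; split=> //; first exact: subset_trans mA.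
  by exists (a * a); [apply: aN; exists a|rewrite mulf_neq0].
- by exists [set a * x | x in m]; split=> //; apply: dcc_refl.
suff mN : m `<=` N by apply: dcc_sub dN _ _.
move=> x mx; apply: (maxN (addmod N (cyclic x))); last first.
- by apply: addmodr => //; apply: cyclic_id.
- by apply: addmodl; apply: cyclic_amodule.
have Cx := cyclic_amodule x; split.
- exact: addmod_amodule.
- by apply: subset_trans aN _; apply: addmodl.
- by apply: addmod_min => //; apply: cyclic_min.
apply: (dcc_trans (M := N)) => //; first exact: addmod_amodule.
  exact: addmodl.
apply: dcc_simple => // b mb; apply: aN.
by have [z mz ->] := mm _ _ mb mx; exists z.
Qed.

(* Krull's principal ideal theorem when [m ^ 2 = a m]; the ideals [W n] play the
   role of the symbolic powers in the classical proof. *)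
Lemma principal_reduction_power a b : m a ->
  (forall x y, m x -> m y -> exists2 z, m z & x * y = a * z) ->
  A b -> b != 0 -> exists j, exists2 y, A y & a ^+ j = b * y.
Proof.
move=> ma mm Ab b0.
have [HA A1 _ Hm [mA m1 _]] := Aloc; have [m0 mD mZ] := Hm.
have AZ x y : A x -> A y -> A (x * y) by move=> ? ?; case: HA => _ _; apply.
have [a0|a0] := eqVneq a 0.
  by exists 1%N, 0; rewrite ?mulr0 //; case: HA.
have AX x k : A x -> A (x ^+ k) by move=> Ax; elim: k => // k IH; rewrite exprS; apply: AZ.
(* [W n] is the contraction to [m] of [b ^+ n A[1/a]]. *)
pose W n := [set x | m x /\ exists j, exists2 y, A y & a ^+ j * x = b ^+ n * y].
have HW n : amodule (W n).
  split.
  - by split=> //; exists 0%N, 0; rewrite ?mulr0 //; case: HA.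
  - move=> x y [mx [j [x' Ax' xE]]] [my [k [y' Ay' yE]]]; split; first exact: mD.
    exists (j + k)%N, (a ^+ k * x' + a ^+ j * y').
      by case: (HA) => _ AD _; apply: AD; apply: AZ => //; apply/AX/mA.
    have -> : a ^+ (j + k) * (x + y) = a ^+ k * (a ^+ j * x) + a ^+ j * (a ^+ k * y).
      by rewrite exprD; ring.
    by rewrite xE yE; ring.
  - move=> c x Ac [mx [j [x' Ax' xE]]]; split; first exact: mZ.
    by exists j, (c * x'); [apply: AZ|rewrite mulrCA xE; ring].
have Ham := image_amodule a Hm.
have WSn n : W n.+1 `<=` W n.
  move=> x [mx [j [y Ay xE]]]; split=> //; exists j, (b * y); first exact: AZ.
  by rewrite xE exprS; ring.
have [||_ [n _ <-] minW] := dcc_principal_reduction a0 ma mm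
    (Fam := [set addmod (W n) [set a * x | x in m] | n in setT]).
- move=> _ [n _ <-]; split; first exact: addmod_amodule.
    exact: addmodr.
  apply: addmod_min => // [x []//|_ [x mx <-]].
  by apply: mZ => //; apply: mA.
- by eexists; exists 0%N.
have Wb k : W k (a * b ^+ k).
  split; first by rewrite mulrC; apply: mZ => //; apply: AX.
  by exists 0%N, a; [apply: mA|rewrite mul1r mulrC].
(* By minimality [W n] lies in [W n.+1 + a m]. The component [a z] is in [W n], and then so is [z],
   because powers of [a] are absorbed; Nakayama applies. *)
have WW : W n `<=` W n.+1.
  apply: (nakayama (a := a)) => //.
  - by move=> x [/mA].
  - by exists (a * b ^+ n.+1) => //; rewrite mulf_neq0 ?expf_neq0.
  move=> x Wx; have [y [_ [Wy [z mz <-] xE]]] :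
      addmod (W n.+1) [set a * x | x in m] x.
    by apply: minW; [exists n.+1|apply: addmodS|apply: addmodl].
  exists y, z; split=> //.
  have : W n (a * z).
    rewrite (_ : a * z = x - y); last by rewrite xE addrAC subrr add0r.
    by apply: amodule_sub => //; apply: WSn.
  move=> [_ [j [t At tE]]]; split=> //; exists j.+1, t => //.
  by rewrite exprSr -mulrA.
(* Cancelling [b ^+ n] from the membership of [a b ^+ n] in [W n.+1] leaves [a ^+ j.+1 = b y]. *)
have [_ [j [y Ay yE]]] := WW _ (Wb n).
exists j.+1, y => //; apply: (mulfI (expf_neq0 n b0)).
by rewrite mulrA -exprSr -yE exprSr; ring.
Qed.

(** An ideal [N] maximal among those over [b] with [A / N] not Artinian is prime: if [x y] is in [N]
    but [x] and [y] are not, then [A / (N + A x)] and [(N + A x) / N], a copy of [A / (N : x)], are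
    Artinian. So [N = m], yet [A / m] is simple. *)
Lemma dcc_one_dimensional b :
  (forall p, amodule p -> p `<=` m -> (exists2 x, p x & x != 0) ->
    (forall x y, A x -> A y -> p (x * y) -> p x \/ p y) -> m `<=` p) ->
  A b -> b != 0 -> dcc (cyclic b) A.
Proof.
move=> dim1 Ab b0; apply: contrapT => ndcc.
have [HA A1 _ Hm [mA m1 _]] := Aloc.
have Cb := cyclic_amodule b.
have [||N [HN bN NA dN] maxN] := Anoeth (Fam :=
  [set N | [/\ amodule N, cyclic b `<=` N, N `<=` A & ~ dcc N A]]).
- move=> N [HN bN NA _]; split=> //; exists b => //; by apply: bN; apply: cyclic_id.
- by exists (cyclic b); split=> //; apply: cyclic_min.
have big N' : amodule N' -> N' `<=` A -> N `<=` N' -> ~ N' `<=` N -> dcc N' A.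
  move=> HN' N'A NN' nN'; apply: contrapT => dN'; apply: nN'; apply: maxN => //.
  by split=> //; apply: subset_trans NN'.
have Nm : N `<=` m.
  move=> x Nx; apply: contrapT => mx; apply: dN.
  have AN := amodule_eqA HN (NA _ Nx) mx Nx.
  exact: (dcc_sub (@dcc_refl A) AN).
have mN : m `<=` N.
  apply: dim1 => //; first by exists b => //; by apply: bN; apply: cyclic_id.
  move=> x y Ax Ay Nxy; apply: contrapT => /not_orP[Nx Ny]; apply: dN.
  have Cx := cyclic_amodule x.
  have HNx := addmod_amodule HN Cx.
  have NNx := addmodl (N := N) Cx.
  have NxA : addmod N (cyclic x) `<=` A by apply: addmod_min => //; apply: cyclic_min.
  apply: (dcc_trans (M := addmod N (cyclic x))) => //; last first.
    by apply: big => // H; apply/Nx/H/addmodr => //; apply: cyclic_id.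
  (* [P W] is the ideal [(W : x)]; it transports modules between [N] and [N + A x] to ideals over
     [(N : x)], which contains [y]. *)
  pose P W := [set z | W (x * z)] `&` A.
  have HP W : amodule W -> amodule (P W).
    by move=> HW; apply: setI_amodule => //; apply: preimage_amodule.
  have dP : dcc (P N) A.
    apply: big; first exact: HP.
    - by move=> z [].
    - by move=> z Nz; split; [case: HN => _ _; apply|apply: NA].
    - by move=> H; apply: Ny; apply: H.
  move=> Fam HF [W0 FW0].
  have [||_ [W FW <-] minW] := dP [set P W | W in Fam].
  - move=> _ [W /HF[HW NW WN] <-]; split; first exact: HP.
      by move=> z [/NW].
    by move=> z [].
  - by exists (P W0), W0.
  exists W => // W' FW' W'W w Ww; have [HW NW WN] := HF _ FW.
  have [HW' NW' _] := HF _ FW'.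
  have [n [_ [Nn [a Aa <-] wE]]] := WN _ Ww.
  have [+ _] : P W' a.
    apply: minW => [|z [/W'W //]|]; first by exists W'.
    split=> //=; rewrite mulrC (_ : a * x = w - n); last first.
      by rewrite wE addrAC subrr add0r.
    by apply: amodule_sub => //; apply: NW.
  by rewrite wE mulrC => W'ax; case: HW' => _ WD _; apply: WD => //; apply: NW'.
apply: dN; have C1 := cyclic_amodule 1.
apply: (dcc_sub (N := N) (M' := A)) (dcc_simple (x := 1) HN _) _ _ => //.
  by move=> a ma; rewrite mulr1; apply: mN.
by move=> x Ax; apply: addmodr => //; exists x; rewrite ?mulr1.
Qed.

(* Noetherian induction on the submodules [x E <= N <= E] for which some [u] with
   [1 - u] in [H] maps [N] into [x E]. If such an [N] is not [E], then by [dcc]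
   there is a simple module over it, and [E : J = E] keeps this simple module
   from being killed by [J]; so some [1 - t i] kills it. *)
Lemma colon_fixed_unit (E H J : set K) (x e j : K) :
  (forall b, A b -> b != 0 -> dcc (cyclic b) A) ->
  amodule E -> (forall i y, J i -> E y -> E (i * y)) ->
  (forall y, (forall i, J i -> E (i * y)) -> E y) ->
  (forall h h', H h -> H h' -> H (h + h')) ->
  (forall t h, (forall y, E y -> E (t * y)) -> H h -> H (t * h)) ->
  J `<=` H -> J x -> x != 0 -> E e -> e != 0 ->
  j != 0 -> (forall y, E y -> A (j * y)) -> H 1.
Proof.
move=> dA HE JE EJ HD HZ JH Jx x0 Ee e0 j0 jE; have [E0 ED EZ] := HE.
(* [B] is the endomorphism ring [(E : E)]; the simple module below is simple over [B]. *)
pose B t := forall y, E y -> E (t * y).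
have BA a : A a -> B a by move=> Aa y; apply: EZ.
have BD s t : B s -> B t -> B (s + t).
  by move=> Bs Bt y Ey; rewrite mulrDl; apply: ED; [apply: Bs|apply: Bt].
have BM s t : B s -> B t -> B (s * t).
  by move=> Bs Bt y Ey; rewrite -mulrA; apply/Bs/Bt.
have BJ i : J i -> B i by move=> Ji y; apply: JE.
have [_ A1 A_1 _ _] := Aloc.
have BB1 t : B t -> B (1 - t).
  by move=> Bt; rewrite -mulN1r; apply: BD; [apply: BA|apply: BM Bt; apply: BA].
pose stab N := forall t y, B t -> N y -> N (t * y).
pose kills N := exists u,
  [/\ B u, H (1 - u) & forall y, N y -> exists2 z, E z & u * y = x * z].
pose Fam N := [/\ amodule N, stab N, (forall y, E y -> N (x * y)), N `<=` E & kills N].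
(* Multiplication by [j] carries submodules of [E] into [A], where [Anoeth] applies. *)
have [||_ [N [HN sN xN NE [u [Bu Hu uN]]] <-] maxN] :=
    Anoeth (Fam := [set [set j * y | y in N] | N in Fam]).
- move=> _ [N [HN sN xN NE kN] <-]; split; first exact: image_amodule.
    by move=> _ [y /NE Ey <-]; apply: jE.
  exists (j * (x * e)); last by rewrite !mulf_neq0.
  by exists (x * e) => //; apply: xN.
- eexists; exists [set x * y | y in E] => //; split.
  + exact: image_amodule.
  + by move=> t _ Bt [y Ey <-]; exists (t * y); [apply: Bt|rewrite mulrCA].
  + by move=> y Ey; exists y.
  + by move=> _ [y Ey <-]; apply: JE.
  + exists 1; split; first exact: BA.
      rewrite subrr -(mul0r x); apply: HZ; last exact: JH.
      by move=> y _; rewrite mul0r.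
    by move=> _ [y Ey <-]; exists y; rewrite ?mul1r.
have maxN' N' y : Fam N' -> N `<=` N' -> N' y -> N y.
  move=> FN' NN' N'y.
  have [z Nz /(mulfI j0) <- //] : [set j * y | y in N] (j * y).
    apply: (maxN [set j * y | y in N']); [by exists N'| |by exists y].
    exact: image_subset.
pose adj y := [set w | exists n t, [/\ N n, B t & w = n + t * y]].
have HNy y : E y -> [/\ amodule (adj y), stab (adj y), N `<=` adj y, adj y `<=` E & adj y y].
  have [N0 ND NZ] := HN.
  move=> Ey; have sN1 : stab (adj y).
    move=> t _ Bt [n [s [Nn Bs ->]]]; exists (t * n), (t * s).
    by split; [apply: sN|apply: BM|rewrite mulrDr mulrA].
  split=> //.
  - split.
    + by exists 0, 0; split=> //; [move=> z _; rewrite mul0r|rewrite mul0r addr0].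
    + move=> _ _ [n [t [Nn Bt ->]]] [n' [t' [Nn' Bt' ->]]].
      by exists (n + n'), (t + t'); split; [apply: ND|apply: BD|ring].
    + by move=> a z /BA; apply: sN1.
  - move=> n Nn; exists n, 0; split=> //; last by rewrite mul0r addr0.
    by move=> z _; rewrite mul0r.
  - by move=> _ [n [t [/NE En Bt ->]]]; apply: ED => //; apply: Bt.
  - by exists 0, 1; split=> //; [apply: BA|rewrite mul1r add0r].
have EN : E `<=` N.
  move=> y0 Ey0; apply: contrapT => Ny0.
  have dNE : dcc N E.
    have [_ _ AZ] : amodule A by case: Aloc.
    apply: (dcc_scale j0); apply: (@dcc_sub (cyclic (j * (x * e))) A).
    - apply: dA; last by rewrite !mulf_neq0.
      by apply: jE; apply: JE.
    - move=> _ [a Aa <-]; exists (x * (a * e)); last by ring.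
      by apply: xN; apply: EZ.
    - by move=> _ [y Ey <-]; apply: jE.
  (* [N1 / N] is simple over [B]: any element of [N1] outside [N] generates it, which is [gen]
     below. *)
  have [||N1 [HN1 sN1 NN1 N1E nN1] minN1] := dNE
      [set W | [/\ amodule W, stab W, N `<=` W, W `<=` E & ~ W `<=` N]].
  - by move=> W [].
  - by have [? ? ? ? ?] := HNy _ Ey0; eexists; split; eauto.
  have [y N1y Ny] : exists2 y, N1 y & ~ N y.
    by apply: contrapT => H1; apply: nN1 => y N1y; apply: contrapT => ?; apply: H1; exists y.
  have gen z w : N1 z -> ~ N z -> N1 w -> adj z w.
    move=> N1z Nz; have [? ? ? ? N2z] := HNy _ (N1E _ N1z).
    apply: (minN1 (adj z)) => //; first by split=> // H2; apply/Nz/H2.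
    move=> _ [n [t [Nn Bt ->]]]; have [_ N1D _] := HN1.
    by apply: N1D; [apply: NN1|apply: sN1].
  (* If [J y] lay in [N], then [J (u y / x)] would lie in [E], hence [u y / x] would too, and [u]
     would already map [N + B y] into [x E]. *)
  have [i Ji Niy] : exists2 i, J i & ~ N (i * y).
    apply: contrapT => H1.
    have JN i : J i -> N (i * y).
      by move=> Ji; apply: contrapT => ?; apply: H1; exists i.
    have Euy : E (u * y / x).
      apply: EJ => i Ji; have [z Ez zE] := uN _ (JN _ Ji).
      by rewrite (_ : i * (u * y / x) = z) // mulrA mulrCA zE mulrC mulKf.
    have [Hm1 Hm2 Hm3 Hm4 N2y] := HNy _ (N1E _ N1y).
    apply: (Ny); apply: (maxN' _ _ _ Hm3 N2y); split=> //.
      by move=> z Ez; apply: Hm3; apply: xN.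
    exists u; split=> // _ [n [t [/uN[z Ez zE] Bt ->]]].
    exists (z + t * (u * y / x)); first by apply: ED => //; apply: Bt.
    by rewrite !mulrDr zE; field.
  (* Since [i y] generates [N1] modulo [N], some [1 - t i] maps [N1] into [N], and [u (1 - t i)]
     then maps it into [x E]. *)
  have [n [t [Nn Bt yE]]] := gen _ _ (sN1 _ _ (BJ _ Ji) N1y) Niy N1y.
  have Bti := BM _ _ Bt (BJ _ Ji).
  apply: (Ny); apply: (maxN' _ _ _ NN1 N1y); split=> //.
    by move=> z Ez; apply: NN1; apply: xN.
  exists (u * (1 - t * i)); split.
  - by apply: BM => //; apply: BB1.
  - rewrite (_ : _ - _ = (1 - u) + u * t * i); last by ring.
    by apply: HD => //; apply: HZ; [apply: BM|apply: JH].
  - move=> w N1w; have [n' [t' [Nn' Bt' ->]]] := gen _ _ N1y Ny N1w.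
    rewrite -mulrA; apply: uN.
    rewrite (_ : _ * _ = (1 - t * i) * n' + t' * n).
      by case: (HN) => _ ND _; apply: ND; apply: sN => //; apply: BB1.
    rewrite (_ : n = y - t * (i * y)); last by rewrite {1}yE addrK.
    by ring.
(* Now [u E] lies in [x E]; so [u = (u / x) x] is in [H], and so is [1 = (1 - u) + u]. *)
have Bux : B (u / x).
  move=> y /EN/uN[z Ez zE]; rewrite (_ : u / x * y = z) //.
  by rewrite mulrAC zE mulrC mulKf.
have Hu' : H u by rewrite -(mulfVK x0 u); apply: HZ => //; apply: JH.
by rewrite -(subrK u 1); apply: HD.
Qed.

End LocalSubrings.

(** * Divisorial ideals, t-ideals and w-ideals *)

Section StrongMori.
Local Set Implicit Arguments.
Local Unset Strict Implicit.
Local Open Scope classical_set_scope.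
Variable R : idomainType.
Local Notation F := {fraction R}.
Local Notation tofrac := (@FracField.tofrac R).
Local Notation "x %:F" := (tofrac x).
Local Notation base := (@base_ring R).
Local Notation span := (@Defs.span R).
Implicit Types (I J N : set F) (P Q : set R) (x y z : F) (r s : R).

Lemma base_id r : base r%:F. Proof. by exists r. Qed.

Lemma baseM x y : base x -> base y -> base (x * y).
Proof. by move=> [a _ <-] [b _ <-]; exists (a * b); rewrite ?rmorphM. Qed.

Lemma mul_base_submodule x : submodule [set y | base (x * y)].
Proof.
have [B0 BD BZ] := base_submodule R; split=> [|u v|r u] /=.
- by rewrite mulr0.
- by rewrite mulrDr; apply: BD.
- by rewrite mulrCA; apply: BZ.
Qed.

Lemma inv_span (l : seq F) x : (forall y, y \in l -> base (x * y)) -> ideal_inv (span l) x.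
Proof. by move=> H y; apply: (span_sub (mul_base_submodule x)). Qed.

Lemma inv_v I : ideal_inv (v_closure I) = ideal_inv I.
Proof.
apply/seteqP; split=> x Hx y; first by move/sub_v; apply: Hx.
by rewrite mulrC; apply.
Qed.

Lemma t_closure_sub_v I : t_closure I `<=` v_closure I.
Proof. by move=> x [J [_ _ JI]]; apply: v_mono. Qed.

Lemma base_fractional : fractional_ideal base.
Proof.
split; first exact: base_submodule.
  by exists 1; [exists 1; rewrite ?rmorph1|rewrite oner_neq0].
by exists 1; rewrite ?oner_neq0 // rmorph1 => x; rewrite mul1r.
Qed.

Lemma t_ideal_base : t_ideal base.
Proof.
split; first exact: base_fractional.
apply/seteqP; split; first exact: sub_t base_fractional.
move=> x /t_closure_sub_v/(_ 1); rewrite mulr1; apply.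
by move=> y; rewrite mul1r.
Qed.

Lemma t_ideal_scale (c : F) I : c != 0 -> t_ideal I -> t_ideal (scale c I).
Proof.
move=> c0 [HI IE]; split; first exact: scale_fractional.
by rewrite t_scale // -IE.
Qed.

Lemma t_ideal_setI I J : t_ideal I -> t_ideal J -> (exists2 x, (I `&` J) x & x != 0) ->
  t_ideal (I `&` J).
Proof.
move=> [HI IE] [HJ JE] IJ0; have HIJ : fractional_ideal (I `&` J).
  have [[I0 ID IZ] _ [d d0 Hd]] := HI; have [[J0 JD JZ] _ _] := HJ.
  split=> //; last by exists d => // x [/Hd].
  split=> //; first by move=> x y [? ?] [? ?]; split; [apply: ID|apply: JD].
  by move=> r x [? ?]; split; [apply: IZ|apply: JZ].
split=> //; apply/seteqP; split; first exact: sub_t.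
move=> x Hx; split; [rewrite IE|rewrite JE]; apply: t_mono Hx.
  by move=> y [].
by move=> y [].
Qed.

Lemma v_span_t_ideal (l : seq F) : fractional_ideal (span l) -> t_ideal (v_closure (span l)).
Proof.
move=> Hl; rewrite (_ : v_closure _ = t_closure (span l)); first exact: t_ideal_t.
apply/seteqP; split; last exact: t_closure_sub_v.
by move=> x Hx; exists (span l); split=> //; exists l.
Qed.

Lemma sub_w I : fractional_ideal I -> I `<=` w_closure I.
Proof.
move=> [[_ _ IZ] _ _] x Ix; exists base; split=> //; first exact: base_fractional.
- exists [:: 1]; apply/seteqP; split.
    by move=> _ [r _ <-]; exists (fun=> r); rewrite big_ord1 mulr1.
  apply: span_sub; first exact: base_submodule.
  by move=> y; rewrite inE => /eqP ->; exists 1; rewrite ?rmorph1.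
- apply/seteqP; split=> y Hy; last by move=> z; apply: baseM.
  by rewrite -[y]mulr1; apply: Hy; exists 1; rewrite ?rmorph1.
- by move=> _ [r _ <-]; rewrite mulrC; apply: IZ.
Qed.

(** If [x J] lies in [I] and [J] has inverse [R], then [J_v = R], so [x] is in [(x J)_v], which lies
    in [I_t]. The chain condition on w-ideals thus covers t-ideals. *)
Lemma t_ideal_w_ideal I : t_ideal I -> w_ideal I.
Proof.
move=> [HI IE]; split=> //; apply/seteqP; split; first exact: sub_w.
have [SI _ _] := HI.
move=> x [J [HJ [l JE] _ invJ xJ]].
have [x0|x0] := eqVneq x 0; first by rewrite x0; case: SI.
have [_ [y Jy y0] _] := HJ.
have [z zl z0] : exists2 z, z \in l & z != 0.
  apply: contrapT => H; move/eqP: y0; apply; move: Jy; rewrite JE => -[c ->].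
  apply: big1 => i _; rewrite (_ : l`_i = 0) ?mulr0 //.
  by apply/eqP; apply: contrapT => /negP ?; apply: H; exists l`_i => //; apply: mem_nth.
rewrite IE -[x]mulr1; apply: (@t_in R _ l) => //.
- by move=> u ul; apply: xJ; rewrite JE; apply: span_mem.
- by exists z.
- by rewrite -JE; move=> u; rewrite invJ mul1r.
Qed.

(** * Primes and localizations inside the fraction field *)

Definition prime_set P : Prop :=
  [/\ P 0, ~ P 1, (forall r s, P r -> P s -> P (r + s)),
      (forall r s, P s -> P (r * s)) & (forall r s, P (r * s) -> P r \/ P s)].

Lemma t_primeE P : t_prime P <-> prime_set P /\ t_ideal (tofrac @` P).
Proof.
split.
  move=> [[P0 P1 PD] PP tP]; split=> //; move: P0 P1.
  rewrite !in_setE notin_setE => P0 P1; split=> //.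
  - by move=> r s Pr Ps; have := PD 1 r s; rewrite !in_setE mul1r; apply.
  - by move=> r s Ps; have := PD r s 0; rewrite !in_setE addr0; apply.
  - by move=> r s Prs; have := PP r s; rewrite !in_setE => /(_ Prs)/orP[]; rewrite in_setE; [left|right].
move=> [[P0 P1 PD PZ PP] tP]; split=> //.
  split; rewrite ?in_setE ?notin_setE // => a r s; rewrite !in_setE => Pr Ps.
  by apply: PD => //; apply: PZ.
move=> r s; rewrite in_setE => /PP[?|?]; apply/orP; [left|right]; exact/mem_set.
Qed.

Lemma tofrac_imageE P r : (tofrac @` P) r%:F <-> P r.
Proof.
split; last by exists r.
by move=> [s Ps] /eqP; rewrite tofrac_eq => /eqP <-.
Qed.

Lemma tofrac_image_preimage I : tofrac @` [set r | I r%:F] = I `&` base.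
Proof.
apply/seteqP; split; first by move=> _ [r Ir <-]; split=> //; exists r.
by move=> x [Ix [r _ rE]]; exists r => //; move: Ix; rewrite -rE.
Qed.

(* The localization [N_Q] as a subset of the fraction field. *)
Definition loc Q N : set F := [set x | exists2 s, ~ Q s & N (s%:F * x)].

Lemma sub_loc Q N : prime_set Q -> N `<=` loc Q N.
Proof. by move=> [_ Q1 _ _ _] x Nx; exists 1; rewrite ?rmorph1 ?mul1r. Qed.

Lemma loc_amodule Q N : prime_set Q -> submodule N -> amodule (loc Q base) (loc Q N).
Proof.
move=> QP [N0 ND NZ]; have [_ Q1 _ _ QM] := QP; split.
- by exists 1; rewrite ?mulr0.
- move=> x y [s Qs Nx] [s' Qs' Ny]; exists (s * s'); first by move=> /QM[].
  rewrite mulrDr !rmorphM /=; apply: ND.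
    by rewrite -mulrA mulrCA; apply: NZ.
  by rewrite -mulrA; apply: NZ.
- move=> a x [s Qs [r _ aE]] [s' Qs' Nx]; exists (s * s'); first by move=> /QM[].
  by rewrite rmorphM /= mulrACA -aE; apply: NZ.
Qed.

Lemma loc_local_subring Q : prime_set Q ->
  local_subring (loc Q base) (loc Q (tofrac @` Q)).
Proof.
move=> QP; have HA := loc_amodule QP (base_submodule R).
have [Q0 Q1 QD QZ QM] := QP.
split=> //.
- by apply: sub_loc => //; exists 1; rewrite ?rmorph1.
- by apply: sub_loc => //; exists (-1); rewrite ?rmorphN ?rmorph1.
- apply: loc_amodule => //; split.
  + by exists 0; rewrite ?rmorph0.
  + by move=> _ _ [r Qr <-] [s Qs <-]; exists (r + s); rewrite ?rmorphD //; apply: QD.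
  + by move=> r _ [s Qs <-]; exists (r * s); rewrite ?rmorphM //; apply: QZ.
- split.
  + by move=> x [s Qs [r Qr rE]]; exists s => //; exists r.
  + by move=> [s Qs]; rewrite mulr1 => /tofrac_imageE.
  + move=> x [s Qs [r _ rE]] mx; exists r.
      by move=> Qr; apply: mx; exists s => //; exists r.
    have [x0|x0] := eqVneq x 0; first by rewrite x0 invr0 mulr0; case: (base_submodule R).
    by rewrite rE mulfK //; exists s.
Qed.

(** * Consequences of the strong Mori condition *)

Hypothesis R_strong_mori : strong_mori R.

(** Without a maximal member, iterating a choice of strictly larger members gives a chain that never
    stabilizes. *)
Lemma max_w_ideal (Fam : set (set F)) :
  (forall I, Fam I -> w_ideal I /\ I `<=` base) -> (exists I, Fam I) ->
  exists2 I, Fam I & forall J, Fam J -> I `<=` J -> J `<=` I.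
Proof.
move=> HF [I0 FI0]; apply: contrapT => nmax.
have [|next nextP] := @boolp.choice _ _ (fun I N : set F =>
    Fam I -> [/\ Fam N, I `<=` N & ~ N `<=` I]).
  move=> I; have [FI|nFI] := pselect (Fam I); last by exists I.
  apply: contrapT => H; apply: nmax; exists I => // J FJ IJ.
  by apply: contrapT => JI; apply: H; exists J.
pose c n := iter n next I0.
have Fc n : Fam (c n) by elim: n => // n /nextP[].
have [n|n|n] := R_strong_mori (I := c); first exact: HF.
  by have [] := nextP _ (Fc n).
move=> /(_ n.+1 (leqnSn n)) cE.
have : ~ (c n.+1 `<=` c n) by have [] := nextP _ (Fc n).
by rewrite cE; apply.
Qed.

(** Scaling by [d] moves [I] into [R]. If [d (l)_v] is maximal for finite [l] in [I], adjoining any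
    [y] of [I] to [l] does not enlarge it, so [y] is in [(l)_v]. *)
Lemma t_ideal_v_finite I : t_ideal I -> exists l : seq F,
  [/\ forall x, x \in l -> I x, exists2 x, x \in l & x != 0 & I = v_closure (span l)].
Proof.
move=> [HI IE]; have [SI [x Ix x0] [d d0 Hd]] := HI.
pose good (l : seq F) := (forall x, x \in l -> I x) /\ (exists2 x, x \in l & x != 0).
have dF0 : d%:F != 0 by rewrite tofrac_eq0.
have vI l : good l -> v_closure (span l) `<=` I.
  by move=> [l1 l2]; rewrite IE => y Hy; apply: t_intro Hy.
have [||_ [l gl <-] maxl] := @max_w_ideal
    [set scale d%:F (v_closure (span l)) | l in good].
- move=> _ [l gl <-]; split; last by move=> _ [y /(vI _ gl) Iy <-]; apply: Hd.
  apply: t_ideal_w_ideal; apply: t_ideal_scale => //; apply: v_span_t_ideal.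
  by case: gl => l1 l2; apply: span_fractional HI _ _.
- eexists; exists [:: x] => //; split; last by exists x; rewrite ?inE.
  by move=> y; rewrite inE => /eqP ->.
exists l; have [l1 l2] := gl; split=> //; apply/seteqP; split; last exact: vI.
move=> y Iy; have gyl : good (y :: l).
  split; first by move=> z; rewrite inE => /orP[/eqP ->|/l1].
  by case: l2 => z zl z0; exists z; rewrite // inE zl orbT.
have [z Hz /(mulfI dF0) <- //] : scale d%:F (v_closure (span l)) (d%:F * y).
  apply: (maxl (scale d%:F (v_closure (span (y :: l))))).
  - by exists (y :: l).
  - apply: image_subset; apply: v_mono; apply: span_sub; first exact: span_submodule.
    by move=> u ul; apply: span_mem; rewrite inE ul orbT.
  - by exists y => //; apply: sub_v; apply: span_mem; rewrite inE eqxx.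
Qed.

(** A maximal proper integral t-ideal [M] containing [I]&[R] is prime: if [r s] is in [M] and [s] is
    not, the elements of [R] that multiply [s] into [M] form a proper t-ideal containing [M] and
    [r]. *)
Lemma exists_t_prime I : t_ideal I -> ~ I 1 ->
  exists2 Q, t_prime Q & forall r, I r%:F -> Q r.
Proof.
move=> tI I1; have [[SI [x Ix x0] [d d0 Hd]] _] := tI.
have dF0 : d%:F != 0 by rewrite tofrac_eq0.
have [||M [tM MB IM M1] maxM] := @max_w_ideal
    [set M | [/\ t_ideal M, M `<=` base, I `&` base `<=` M & ~ M 1]].
- by move=> M [tM MB _ _]; split=> //; apply: t_ideal_w_ideal.
- exists (I `&` base); split=> //; last by case.
    apply: t_ideal_setI => //; first exact: t_ideal_base.
    exists (d%:F * x); last by rewrite mulf_neq0.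
    by split; [case: SI => _ _; apply|apply: Hd].
pose Q : set R := [set r | M r%:F].
exists Q; last by move=> r Ir; apply: IM; split=> //; exists r.
have [[[M0 MD MZ] [m0 Mm0 m00] _] _] := tM.
apply: (t_primeE Q).2; split; last by rewrite tofrac_image_preimage setIidl.
rewrite {}/Q; split=> /=.
- by rewrite rmorph0.
- by rewrite rmorph1.
- by move=> r s; rewrite rmorphD; apply: MD.
- by move=> r s; rewrite rmorphM; apply: MZ.
move=> r s; rewrite rmorphM /= => Mrs; apply: contrapT => /not_orP[Mr Ms].
have s0 : s%:F != 0 by apply/eqP => s0; apply: Ms; rewrite s0.
have MN : M `<=` scale s%:F^-1 M `&` base.
  move=> y My; split; last exact: MB.
  by exists (s%:F * y); [apply: MZ|rewrite mulKf].
have tN : t_ideal (scale s%:F^-1 M `&` base).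
  apply: t_ideal_setI; [|exact: t_ideal_base|].
    by apply: t_ideal_scale tM; rewrite invr_eq0.
  by exists m0 => //; apply: MN.
have [N1|N1] := pselect ((scale s%:F^-1 M `&` base) 1).
  by case: N1 => -[y My yE] _; apply: Ms; rewrite -[s%:F]mulr1 -yE mulVKf.
apply: Mr; apply: (maxM (scale s%:F^-1 M `&` base)) => //.
  split=> //.
  exact: subset_trans MN.
split; last by exists r.
by exists (r%:F * s%:F); rewrite // mulrC mulfK.
Qed.

Lemma loc_common (T : eqType) Q N (l : seq T) (f : T -> F) : prime_set Q -> submodule N ->
  (forall t, t \in l -> loc Q N (f t)) ->
  exists2 s, ~ Q s & forall t, t \in l -> N (s%:F * f t).
Proof.
move=> QP [_ _ NZ]; have [_ Q1 _ _ QM] := QP.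
elim: l => [|t l IH] Hl; first by exists 1.
have [|s Qs Hs] := IH; first by move=> u ul; apply: Hl; rewrite inE ul orbT.
have [s' Qs' Hs'] : loc Q N (f t) by apply: Hl; rewrite inE eqxx.
exists (s * s'); first by move=> /QM[].
move=> u; rewrite inE rmorphM /= -mulrA => /orP[/eqP ->|/Hs Nu]; first exact: NZ.
by rewrite mulrCA; apply: NZ.
Qed.

(* A maximal proper [(b R_P : r) `&` R] is prime; it is a t-ideal because it is a
   directed union of the divisorial ideals [(b R : s r)], [s] outside [P]. *)
Lemma prime_contains_t_prime P b : prime_set P -> P b -> b != 0 ->
  exists2 P', t_prime P' & P' `<=` P.
Proof.
move=> PP Pb b0; have [P0 P1 PD PZ PM] := PP.
have bF0 : b%:F != 0 by rewrite tofrac_eq0.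
have SbR := scale_submodule b%:F (base_submodule R).
have [L0 LD LZ] := loc_amodule PP SbR.
have [B0 BD BZ] := base_submodule R.
have baseL : base `<=` loc P base by apply: sub_loc.
have Lb y : base y -> loc P (scale b%:F base) (b%:F * y).
  by move=> By; apply: sub_loc => //; exists y.
pose K r := [set y : F | base y /\ loc P (scale b%:F base) (r%:F * y)].
have KB r : K r `<=` base by move=> y [].
have HK r : fractional_ideal (K r).
  split.
  - split.
    + by split=> //; rewrite mulr0.
    + by move=> x y [Bx Lx] [By Ly]; split; [apply: BD|rewrite mulrDr; apply: LD].
    + move=> t x [Bx Lx]; split; first exact: BZ.
      by rewrite mulrCA; apply: LZ => //; apply: baseL; apply: base_id.
  - exists b%:F => //; split; first exact: base_id.
    by rewrite mulrC; apply: Lb; apply: base_id.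
  - by exists 1; rewrite ?oner_neq0 // rmorph1 => x /KB; rewrite mul1r.
have tK r : t_ideal (K r).
  split=> //; apply/seteqP; split; first exact: sub_t.
  move=> x Kx; split.
    by have [_ ->] := t_ideal_base; apply: t_mono Kx; apply: KB.
  have [l [l1 _ l3]] := t_gen (HK r) Kx.
  (* A common denominator [s] puts [s r l] in [b R]; so [s r / b] is in the inverse of [span l], and
     it multiplies [x] into [R] as well. *)
  have [|s Ps Hs] := @loc_common _ P (scale b%:F base) l (fun y => r%:F * y) PP SbR.
    by move=> y /l1[].
  exists s => //; exists (x * (s%:F * r%:F / b%:F)); last first.
    by rewrite mulrCA [b%:F * _]mulrC (divfK bF0) mulrC mulrA.
  apply: l3; apply: inv_span => y /Hs[z Bz zE].
  by rewrite mulrAC -[_ * y]mulrA -zE [b%:F * z]mulrC (mulfK bF0).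
have [||_ [r <- Kr1] maxK] := @max_w_ideal [set I | exists2 r, K r = I & ~ K r 1].
- by move=> _ [r <- _]; split=> //; apply: t_ideal_w_ideal.
- exists (K 1), 1 => // -[_ [s Ps]].
  rewrite rmorph1 !mulr1 => -[_ [r _ <-]] /eqP; rewrite -rmorphM tofrac_eq => /eqP rE.
  by apply: Ps; rewrite -rE mulrC; apply: PZ.
pose P' : set R := [set y | K r y%:F].
exists P'; last first.
  move=> y [_ [s Ps sE]]; apply: contrapT => Py; apply: Kr1; split.
    by rewrite -[1](rmorph1 tofrac); apply: base_id.
  exists (s * y); first by move=> /PM[].
  by rewrite rmorphM mulr1 /= -mulrA [y%:F * _]mulrC.
have [[[K0 KD KZ] _ _] _] := tK r.
apply: (t_primeE P').2; split; last by rewrite tofrac_image_preimage setIidl.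
rewrite {}/P'; split=> /=.
- by rewrite rmorph0.
- by rewrite rmorph1.
- by move=> y z; rewrite rmorphD; apply: KD.
- by move=> y z; rewrite rmorphM; apply: KZ.
move=> y z; rewrite rmorphM /= => Kyz; apply: contrapT => /not_orP[Ky Kz].
(* [K (r * y)] is proper because [y] is not in [K r]; it contains [K r] and [z]. *)
apply: Kz; apply: (maxK (K (r * y))).
- exists (r * y) => // -[_]; rewrite mulr1 rmorphM => Ly.
  by apply: Ky; split=> //; apply: base_id.
- move=> x [Bx Lx]; split=> //; rewrite rmorphM /= mulrAC mulrC.
  by apply: LZ => //; apply: baseL; apply: base_id.
- split; first exact: base_id.
  by rewrite rmorphM /= -mulrA; case: Kyz.
Qed.

(** An ideal [J] with inverse [R] is not inside the t-prime [Q], as otherwise [1] would be in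
    [Q_t = Q]. An element of [J] outside [Q] is a unit of [R_Q], so if [x J] lies in [N], then so
    does [x]. *)
Lemma loc_setI_w_ideal Q N : t_prime Q -> amodule (loc Q base) N ->
  (exists2 x, (N `&` base) x & x != 0) -> w_ideal (N `&` base).
Proof.
move=> /t_primeE[QP tQ] [N0 ND NZ] NB0; have [Q0 Q1 QD QZ QM] := QP.
have [B0 BD BZ] := base_submodule R.
have HNB : fractional_ideal (N `&` base).
  split=> //; last by exists 1; rewrite ?oner_neq0 // rmorph1 => x []; rewrite mul1r.
  split=> //; first by move=> x y [? ?] [? ?]; split; [apply: ND|apply: BD].
  move=> r x [? ?]; split; [apply: NZ|apply: BZ] => //.
  by apply: sub_loc => //; apply: base_id.
split=> //; apply/seteqP; split; first exact: sub_w.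
move=> x [J [HJ fgJ JB invJ xJ]]; split; last by rewrite -invJ => y /xJ[].
have [g Jg gQ] : exists2 y, J y & ~ (tofrac @` Q) y.
  apply: contrapT => H; apply: Q1; apply/tofrac_imageE.
  have [_ ->] := tQ; rewrite rmorph1; exists J; split=> //.
    by move=> y Jy; apply: contrapT => Qy; apply: H; exists y.
  by rewrite /v_closure invJ => y; rewrite mul1r.
have [t _ tE] := JB _ Jg; have Qt : ~ Q t by move=> Qt; apply: gQ; exists t.
have t0 : t%:F != 0 by rewrite tofrac_eq0; apply/eqP => t0; apply: Qt; rewrite t0.
have [Nxt _] := xJ _ Jg.
rewrite (_ : x = t%:F^-1 * (x * g)); last by rewrite -tE mulrC mulfK.
by apply: NZ => //; exists t => //; rewrite mulfV // -(rmorph1 tofrac); apply: base_id.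
Qed.

(** An [R_Q]-submodule of [R_Q] is recovered from its contraction to [R], so a maximal contraction
    comes from a maximal submodule. *)
Lemma loc_noetherian Q : t_prime Q -> noetherian_subring (loc Q base).
Proof.
move=> tQ Fam HF [N0 FN0]; have [QP _] := (t_primeE Q).1 tQ.
have baseL : base `<=` loc Q base by apply: sub_loc.
have [||_ [M FM <-] maxM] := @max_w_ideal [set N `&` base | N in Fam].
- move=> _ [N /HF[HN NA [x Nx x0]] <-]; split; last by move=> y [].
  apply: (@loc_setI_w_ideal Q) => //; have [s Qs Bsx] := NA _ Nx.
  exists (s%:F * x).
    by split=> //; case: HN => _ _; apply=> //; apply: baseL; apply: base_id.
  rewrite mulf_neq0 // tofrac_eq0; apply/eqP => s0; apply: Qs.
  by rewrite s0; case: QP.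
- by eexists; exists N0.
exists M => // N FN MN x Nx; have [HN NA _] := HF _ FN; have [s Qs Bsx] := NA _ Nx.
have [[_ _ MZ] _ _] := HF _ FM.
have s0 : s%:F != 0.
  by rewrite tofrac_eq0; apply/eqP => s0; apply: Qs; rewrite s0; case: QP.
have [Msx _] : (M `&` base) (s%:F * x).
  apply: (maxM (N `&` base)); [by exists N|by move=> y [/MN]|split=> //].
  by case: HN => _ _; apply=> //; apply: baseL; apply: base_id.
rewrite -(mulKf s0 x); apply: MZ => //.
by exists s => //; rewrite mulfV // -(rmorph1 tofrac); apply: base_id.
Qed.

(** * Inclusions between t-primes and t-dimension one *)

Lemma strongly_t_stable_t_prime_sub P Q : strongly_t_stable R ->
  t_prime P -> t_prime Q -> P `<=` Q -> Q `<=` P.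
Proof.
move=> stR tP tQ PQ; apply: contrapT => QP.
have [PP [[_ [_ [b Pb <-] b0] _] _]] := (t_primeE P).1 tP.
have [PQ' tIQ] := (t_primeE Q).1 tQ; have [Q0 Q1 QD QZ QM] := PQ'.
have [P0 P1 PD PZ PM] := PP.
have [c QE] := stR _ tIQ; set T := colon _ _ in QE.
have [a Qa aE] : (tofrac @` Q) c.
  by rewrite QE; exists 1; rewrite ?mulr1 // => y; rewrite mul1r.
(* Here [q = a t] with [t] in [(Q : Q)], so [q q' = a (t q')]. *)
have Q2 q q' : Q q -> Q q' -> exists2 q'', Q q'' & q * q' = a * q''.
  move=> Qq Qq'.
  have [t Tt tE] : scale c T q%:F by rewrite -QE; exists q.
  have [q'' Qq'' q''E] : (tofrac @` Q) (t * q'%:F) by apply: Tt; exists q'.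
  exists q'' => //; apply/eqP; rewrite -tofrac_eq; apply/eqP.
  by rewrite !rmorphM /= q''E aE -tE mulrA.
have Pa : ~ P a.
  move=> Pa; apply: QP => q Qq; have [q' _ qE] := Q2 _ _ Qq Qq.
  have : P (q * q) by rewrite qE mulrC; apply: PZ.
  by move=> /PM[].
have [||||j [y [s Qs [r _ rE]] yE]] := principal_reduction_power
    (loc_local_subring PQ') (loc_noetherian tQ) (a := a%:F) (b := b%:F).
- by apply: sub_loc => //; exists a.
- move=> x y [s Qs [q Qq qE]] [s' Qs' [q' Qq' q'E]].
  have [q'' Qq'' qqE] := Q2 _ _ Qq Qq'.
  have nz u : ~ Q u -> u%:F != 0.
    by move=> Qu; rewrite tofrac_eq0; apply/eqP => u0; apply: Qu; rewrite u0.
  have s0 := nz _ Qs; have s'0 := nz _ Qs'.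
  have Qss : ~ Q (s * s') by move=> /QM[].
  exists (q''%:F / (s * s')%:F).
    exists (s * s') => //; exists q'' => //.
    by rewrite mulrC (divfK (nz _ Qss)).
  have -> : x = q%:F / s%:F by rewrite qE mulrAC (mulfV s0) mul1r.
  have -> : y = q'%:F / s'%:F by rewrite q'E mulrAC (mulfV s'0) mul1r.
  by rewrite mulrACA -rmorphM qqE !rmorphM /= invfM -mulrA.
- by apply: sub_loc => //; apply: base_id.
- by [].
have Psa : P (s * a ^+ j).
  have -> : s * a ^+ j = r * b.
    apply/eqP; rewrite -tofrac_eq; apply/eqP.
    by rewrite !rmorphM rmorphXn /= yE rE mulrCA mulrC.
  exact: PZ.
have PX k : ~ P (a ^+ k).
  by elim: k => [|k IH]; rewrite ?expr0 // exprS => /PM[].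
by case: (PM _ _ Psa) => [/PQ|/PX].
Qed.

Lemma t_prime_neq0 P : t_prime P -> [set 0] `<` P.
Proof.
move=> /t_primeE[[P0 _ _ _ _] [[_ [_ [b Pb <-] b0] _] _]]; split; first by move=> _ ->.
by move=> /(_ _ Pb) b00; move: b0; rewrite b00 rmorph0 eqxx.
Qed.

Lemma t_dim1_t_prime_sub P Q : t_dim_eq R 1 ->
  t_prime P -> t_prime Q -> P `<=` Q -> Q `<=` P.
Proof.
move=> [_ dim1] tP tQ PQ; apply: contrapT => QP.
suff: (2 <= 1)%N by [].
apply: (dim1 2 (fun i => if i is i'.+1 then if i' is 0%N then P else Q else [set 0])).
split=> //; first by case=> [//|[|[|//]]].
case=> [|[|//]] _ //; exact: t_prime_neq0.
Qed.

(** For a nonzero nonunit [x], the proper t-ideal [x R] yields a t-prime, hence a chain of length 1.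
    A longer chain would contain two t-primes, one strictly inside the other. *)
Lemma strongly_t_stable_t_dim1 : (exists x : R, x != 0 /\ x \isn't a GRing.unit) ->
  strongly_t_stable R -> t_dim_eq R 1.
Proof.
move=> [x [x0 xU]] stR; split.
  have xF0 : x%:F != 0 by rewrite tofrac_eq0.
  have [||Q tQ _] := @exists_t_prime (scale x%:F base).
  - exact: t_ideal_scale xF0 t_ideal_base.
  - move=> [_ [r _ <-]] /eqP; rewrite -rmorphM -(rmorph1 tofrac) tofrac_eq => /eqP xr1.
    by move/negP: xU; apply; apply/unitrPr; exists r.
  exists (fun i => if i is 0%N then [set 0] else Q); split=> //.
    by case.
  by case=> [|//] _; apply: t_prime_neq0.
move=> [|[|m]] // P [P0 tP sP].
have [tP1 tP2] : t_prime (P 1%N) /\ t_prime (P 2%N) by split; apply: tP.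
have [P12 P21] : P 1%N `<` P 2%N by apply: sP.
by case: P21; apply: strongly_t_stable_t_prime_sub.
Qed.

(** A nonzero prime of [R_Q] contracts to a prime inside [Q], which contains a t-prime; by
    t-dimension one this t-prime is [Q], so [R_Q] is one-dimensional. *)
Lemma t_dim1_loc_dcc Q b : t_dim_eq R 1 -> t_prime Q -> loc Q base b -> b != 0 ->
  dcc (loc Q base) (cyclic (loc Q base) b) (loc Q base).
Proof.
move=> dim1 tQ; have [PQ _] := (t_primeE Q).1 tQ; have [Q0 Q1 QD QZ QM] := PQ.
have Aloc := loc_local_subring PQ; have Anoeth := loc_noetherian tQ.
have baseL : base `<=` loc Q base by apply: sub_loc.
apply: (dcc_one_dimensional Aloc Anoeth) => p [p0 pD pZ] pm [x px x0] pM.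
have [_ _ _ _ [mA m1 _]] := Aloc.
have pQ : [set r | p r%:F] `<=` Q.
  move=> r /pm[s Qs]; rewrite -rmorphM => /tofrac_imageE/QM[/Qs//|//].
have [s Qs [r _ rE]] := mA _ (pm _ px).
have r0 : r != 0.
  rewrite -tofrac_eq0 rE mulf_neq0 // tofrac_eq0.
  by apply/eqP => s0; apply: Qs; rewrite s0.
have pr : p r%:F by rewrite rE; apply: pZ => //; apply: baseL; apply: base_id.
have Pp : prime_set [set r | p r%:F].
  split=> /=.
  - by rewrite rmorph0.
  - by rewrite rmorph1 => /pm.
  - by move=> t u; rewrite rmorphD; apply: pD.
  - by move=> t u pu; rewrite rmorphM; apply: pZ => //; apply: baseL; apply: base_id.
  - by move=> t u; rewrite rmorphM; apply: pM; apply: baseL; apply: base_id.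
have [P tP Ppp] := prime_contains_t_prime Pp pr r0.
have QP := t_dim1_t_prime_sub dim1 tP tQ (subset_trans Ppp pQ).
move=> y [t Qt [q Qq qE]].
have t0 : t%:F != 0 by rewrite tofrac_eq0; apply/eqP => t0; apply: Qt; rewrite t0.
rewrite -(mulKf t0 y) -qE; apply: pZ; last by apply: Ppp; apply: QP.
by exists t => //; rewrite mulfV // -(rmorph1 tofrac); apply: base_id.
Qed.

(** * Idempotent t-ideals in t-dimension one *)

Lemma t_idempotent_1 I : t_dim_eq R 1 -> t_ideal I -> t_mul I I = I -> I 1.
Proof.
move=> dim1 tI II; apply: contrapT => I1.
have [Q tQ IQ] := exists_t_prime tI I1.
have [PQ _] := (t_primeE Q).1 tQ; have [Q0 Q1 QD QZ QM] := PQ.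
have [HI _] := tI; have [SI [x Ix x0] [d d0 Hd]] := HI.
have [l [lI _ Il]] := t_ideal_v_finite tI.
have IMI y z : I y -> I z -> I (y * z).
  move=> Iy Iz; rewrite -II; apply: sub_t; first exact: ideal_mul_fractional.
  exact: ideal_mul_in.
pose D := ideal_inv I.
have SD : submodule D by apply/colon_submodule/base_submodule.
have dF0 : d%:F != 0 by rewrite tofrac_eq0.
have Dd : D d%:F by move=> y; apply: Hd.
have Dl : D = ideal_inv (span l) by rewrite -[RHS]inv_v -Il.
have tD : t_ideal D.
  have HD : fractional_ideal D.
    split=> //; first by exists d%:F.
    have [e e0 [r _ rE]] := frac_base x.
    have e0F : e%:F != 0 by rewrite tofrac_eq0.
    exists r; first by rewrite -tofrac_eq0 rE (mulf_neq0 e0F x0).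
    move=> y Dy; rewrite rE -mulrA [x * y]mulrC.
    by have [_ _ BZ] := base_submodule R; apply: BZ; apply: Dy.
  split=> //; apply/seteqP; split; first exact: sub_t.
  by move=> y /t_closure_sub_v; rewrite [v_closure _]inv_v.
(* The finite sets [l] and [g] let membership in [D] and in [I] be tested on finitely many elements,
   as localization requires. *)
have [g [gD _ Dg]] := t_ideal_v_finite tD.
have Ig : I = ideal_inv (span g).
  by rewrite -[RHS]inv_v -Dg Dl.
have ID i y : I i -> D y -> D (i * y).
  by move=> Ii Dy k Ik; rewrite mulrAC mulrC; apply: Dy; apply: IMI.
(* This is [(D : I) = (I^2)^-1 = D], with [I] replaced by [l] so that the equality survives
   localization. *)
have DI y : (forall i, i \in l -> D (i * y)) -> D y.
  move=> Dly; suff Hy : ideal_inv (ideal_mul I I) y.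
    move=> z; rewrite -[I]II => /t_closure_sub_v/(_ _ Hy).
    by rewrite mulrC.
  move=> w; apply: (ideal_mul_sub (mul_base_submodule y)) => i k Ii Ik /=.
  have Dyk : D (y * k).
    rewrite Dl; apply: inv_span => j jl.
    by rewrite mulrAC [y * j]mulrC; apply: (Dly _ jl).
  by rewrite [i * k]mulrC mulrA; apply: Dyk.
pose A := loc Q base; pose E := loc Q D.
have xE j y : I j -> E y -> A (j * y).
  move=> Ij [s Qs Dsy]; exists s => //.
  by rewrite mulrCA mulrC; apply: Dsy.
(* The element [x] serves twice: as a nonzero element of [I], and as the multiplier carrying [E]
   into [A]. *)
have EA : forall y, E y -> A (1 * y).
  apply: (@colon_fixed_unit _ _ _ (loc_local_subring PQ) (loc_noetherian tQ)
            E (colon A E) I x d%:F x) => //.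
  - by move=> b; apply: t_dim1_loc_dcc.
  - exact: loc_amodule.
  - move=> i y Ii [s Qs Dsy]; exists s => //.
    by rewrite mulrCA; apply: ID.
  - move=> y Ey; have [s Qs Hs] := loc_common (f := fun i => i * y) PQ SD
      (fun i il => Ey _ (lI _ il)).
    by exists s => //; apply: DI => i /Hs; rewrite mulrCA.
  - move=> h k Hh Hk y Ey; rewrite mulrDl.
    have [_ AD _] := loc_amodule PQ (base_submodule R).
    by apply: AD; [apply: Hh|apply: Hk].
  - by move=> t h Bt Hh y Ey; rewrite -mulrA mulrCA; apply: Hh; apply: Bt.
  - by move=> i Ii y; apply: xE.
  - exact: sub_loc.
  - by move=> y; apply: xE.
(* A common denominator [s] outside [Q] for the set [g] is in the inverse of [span g], which is [I];
   but integral elements of [I] are in [Q]. *)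
have [|s Qs Hs] := @loc_common _ Q base g id PQ (base_submodule R).
  by move=> y /gD Dy; rewrite -[y]mul1r; apply: EA; apply: sub_loc.
by apply: Qs; apply: IQ; rewrite Ig; apply: inv_span.
Qed.

(** * The Boolean condition and strong t-stability *)

Lemma t_mul_sqr_stable I (a : F) : t_ideal I -> I = scale a (colon I I) ->
  a != 0 /\ t_mul I I = scale a I.
Proof.
move=> [HI It] IE; have [SI [x Ix x0] _] := HI.
have a0 : a != 0.
  by apply/eqP => a0; move: Ix; rewrite IE a0 => -[y _ yE]; move: x0; rewrite -yE mul0r eqxx.
have Ia : I a by rewrite IE; exists 1; rewrite ?mulr1 // => y; rewrite mul1r.
split=> //; rewrite /t_mul (_ : ideal_mul I I = scale a I).
  by rewrite t_scale // -It.
apply/seteqP; split; last by move=> _ [y Iy <-]; apply: ideal_mul_in.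
apply: ideal_mul_sub; first exact: scale_submodule.
move=> y z; rewrite {1}IE => -[t Tt <-] Iz.
by exists (t * z); [apply: Tt|rewrite mulrA].
Qed.

Lemma boole_t_regularP : boole_t_regular R <->
  forall I, t_ideal I -> exists2 c : F, c != 0 & t_mul I I = scale c I.
Proof.
split=> [boole I tI|H x].
  have tI' : `[< t_ideal I >] by apply/asboolP.
  pose X : tideal R := exist _ I tI'.
  have := boole (\pi_(t_class_semigroup R) X)%qT.
  rewrite -[RHS]/(t_class_mul _ _) pi_t_class_mul => /eqmodP/asboolP[c c0 cE].
  by exists c.
elim/quotW: x => X; rewrite -[RHS]/(t_class_mul _ _) pi_t_class_mul.
have /asboolP tX := valP X; have [c c0 cE] := H _ tX.
by apply/eqmodP/asboolP; exists c.
Qed.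

Lemma strongly_t_stable_boole : strongly_t_stable R -> boole_t_regular R.
Proof.
move=> stR; apply/boole_t_regularP => I tI; have [a IE] := stR _ tI.
by have [a0 II] := t_mul_sqr_stable tI IE; exists a.
Qed.

(** If [(I^2)_t = c I], then [c^-1 I] is idempotent, so it contains [1] and [c] is in [I]. As
    products of elements of [I] lie in [c I], [c^-1 I] is inside [(I : I)]. *)
Lemma boole_strongly_t_stable :
  boole_t_regular R -> t_dim_eq R 1 -> strongly_t_stable R.
Proof.
move=> /boole_t_regularP boole dim1 I tI; have [c c0 II] := boole _ tI.
have [HI _] := tI; have [[_ _ IZ] _ _] := HI.
have ci0 : c^-1 != 0 by rewrite invr_eq0.
have [y Iy yE] : scale c^-1 I 1.
  apply: t_idempotent_1 => //; first exact: t_ideal_scale.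
  by rewrite t_mul_scale // II scaleA (mulfVK c0).
have Ic : I c by rewrite -[c]mulr1 -yE mulVKf.
exists c; apply/seteqP; split; last first.
  by move=> _ [t Tt <-]; rewrite mulrC; apply: Tt.
move=> x Ix; exists (c^-1 * x); last exact: mulVKf.
move=> z Iz; have [w Iw wE] : scale c I (x * z).
  by rewrite -II; apply: sub_t; [apply: ideal_mul_fractional|apply: ideal_mul_in].
by rewrite -mulrA -wE (mulKf c0).
Qed.

End StrongMori.

(** Fields are excluded because a field is strongly t-stable but has t-dimension 0. *)
Theorem theorem2p10 (R : idomainType)
    (R_not_field : exists x : R, x != 0 /\ x \isn't a GRing.unit)
    (R_strong_mori : strong_mori R) :
  strongly_t_stable R <-> boole_t_regular R /\ t_dim_eq R 1.
Proof.
split=> [stR|[boole dim1]]; last exact: boole_strongly_t_stable.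
split; first exact: strongly_t_stable_boole.
exact: strongly_t_stable_t_dim1.
Qed.
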